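(* Let $n,k,r$ be positive integers and let $\lambda$ be a partition of $n$. Then $$\dim W^\lambda_{\mathcal{A}_{r,k}(n)}=\text{the coefficient of } q^r \text{ in } s_\lambda\!\left[\frac{1}{(1-q)^k}\right].$$ Moreover, this coefficient is non-zero (that is, the module $W^\lambda_{\mathcal{A}_{r,k}(n)}$ exists) if and only if $$r\ \ge\ \sum_{j\ge1}(j-1)\cdot\sum_{i=t_{j-1}+1}^{t_j}\lambda_i,$$ where $t_d=\binom{k+0-1}{0}+\binom{k+1-1}{1}+\cdots+\binom{k+d-2}{d-1}$ (so $t_0=0$), and $\lambda_d=0$ for $d>\ell(\lambda)$.
   Context: $\mathcal{P}^r(V_{n,k})$ is the space of homogeneous polynomials of degree $r$ over $\mathbb{C}$ in the commuting variables $x_{ij}$, $1\le i\le n$, $1\le j\le k$. The symmetric group $S_n$ acts by $\sigma\cdot x_{i_1j_1}\cdots x_{i_rj_r}=x_{\sigma(i_1)j_1}\cdots x_{\sigma(i_r)j_r}$, and $\mathcal{A}_{r,k}(n)=\mathrm{End}_{\mathbb{C}S_n}(\mathcal{P}^r(V_{n,k}))$. For a partition $\lambda$ of $n$, $W^\lambda_{\mathbb{C}S_n}$ is the irreducible $\mathbb{C}S_n$-module indexed by $\lambda$ (standard labelling, $(n)$ being trivial), and $$W^\lambda_{\mathcal{A}_{r,k}(n)}:=\mathrm{Hom}_{\mathbb{C}S_n}(W^\lambda_{\mathbb{C}S_n},\mathcal{P}^r(V_{n,k})),$$ an $\mathcal{A}_{r,k}(n)$-module by post-composition, which is irreducible when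 non-zero. Plethystic notation: $s_\lambda$ is the Schur function; $s_\lambda\!\left[\frac1{(1-q)^k}\right]$ is the power series in $q$ obtained by expanding $s_\lambda$ in power sums and replacing each $p_m$ by $\frac{1}{(1-q^m)^k}$. $\ell(\lambda)$ is the number of non-zero parts of $\lambda$. *)

(* Defs.v *)
From HB Require Import structures.
From mathcomp Require Import all_boot all_order all_algebra all_fingroup.
From mathcomp Require Import boolp classical_sets reals.
From mathcomp Require Import complex mpoly.

Set Implicit Arguments.
Unset Strict Implicit.
Unset Printing Implicit Defensive.

Import GRing.Theory.
Local Open Scope ring_scope.

Record fps (R : Type) := Fps { fps_coef : nat -> R }.

HB.instance Definition _ (R : Type) := gen_eqMixin (fps R).
HB.instance Definition _ (R : Type) := gen_choiceMixin (fps R).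

Section FpsRing.
Variable R : comNzRingType.
Implicit Types f g h : fps R.

Definition fps_add f g := Fps (fun i => fps_coef f i + fps_coef g i).
Definition fps_opp f := Fps (fun i => - fps_coef f i).
Definition fpsC (c : R) : fps R := Fps (fun i => if i == 0%N then c else 0).
Definition fps_mul f g :=
  Fps (fun m => \sum_(i < m.+1) fps_coef f i * fps_coef g (m - i)%N).

Lemma fpsP f g : fps_coef f =1 fps_coef g -> f = g.
Proof. by case: f g => [f] [g] /= /funext ->. Qed.

Lemma fps_addA : associative fps_add.
Proof. by move=> f g h; apply: fpsP => i /=; rewrite addrA. Qed.
Lemma fps_addC : commutative fps_add.
Proof. by move=> f g; apply: fpsP => i /=; rewrite addrC. Qed.
Lemma fps_add0 : left_id (fpsC 0) fps_add.
Proof. by move=> f; apply: fpsP => i /=; rewrite if_same add0r. Qed.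
Lemma fps_addN : left_inverse (fpsC 0) fps_opp fps_add.
Proof. by move=> f; apply: fpsP => i /=; rewrite if_same addNr. Qed.

HB.instance Definition _ :=
  GRing.isZmodule.Build (fps R) fps_addA fps_addC fps_add0 fps_addN.

Definition fps_trunc N f : {poly R} := \poly_(i < N) fps_coef f i.

Lemma fps_mulE N f g m : (m < N)%N ->
  fps_coef (fps_mul f g) m = (fps_trunc N f * fps_trunc N g)`_m.
Proof.
move=> ltmN; rewrite coefM; apply: eq_bigr => i _.
rewrite !coef_poly (leq_ltn_trans (leq_subr _ _) ltmN).
by rewrite (leq_trans (ltn_ord i) ltmN).
Qed.

Lemma fps_mulC : commutative fps_mul.
Proof.
by move=> f g; apply: fpsP => m; rewrite !(fps_mulE _ _ (ltnSn m)) mulrC.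
Qed.

Lemma fps_mulA : associative fps_mul.
Proof.
move=> f g h; apply: fpsP => m.
transitivity
  ((fps_trunc m.+1 f * (fps_trunc m.+1 g * fps_trunc m.+1 h))`_m).
  rewrite [RHS]coefM; apply: eq_bigr => i _.
  rewrite (@fps_mulE m.+1) ?ltnS ?leq_subr //.
  by rewrite coef_poly ltn_ord.
rewrite mulrA [LHS]coefM; apply: eq_bigr => i _.
rewrite (@fps_mulE m.+1) //; congr (_ * _).
by rewrite coef_poly ltnS leq_subr.
Qed.

Lemma fps_mul1 : left_id (fpsC 1) fps_mul.
Proof.
move=> f; apply: fpsP => m /=.
rewrite big_ord_recl /= mul1r subn0 big1 ?addr0 // => i _.
by rewrite mul0r.
Qed.

Lemma fps_mulDl : left_distributive fps_mul fps_add.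
Proof.
move=> f g h; apply: fpsP => m /=; rewrite -big_split /=.
by apply: eq_bigr => i _; rewrite mulrDl.
Qed.

Lemma fps_1neq0 : fpsC 1 != 0.
Proof.
by apply/eqP => /(congr1 (fun f => fps_coef f 0%N))/eqP /=; rewrite oner_eq0.
Qed.

HB.instance Definition _ :=
  GRing.Zmodule_isComNzRing.Build (fps R)
    fps_mulA fps_mulC fps_mul1 fps_mulDl fps_1neq0.

Definition fps_qX (m : nat) : fps R := Fps (fun i => (i == m)%:R).

(* For [0 < m] this is 1 / (1 - q^m), see [fps_geomP]. *)
Definition fps_geom (m : nat) : fps R := Fps (fun i => (m %| i)%:R).

Lemma fps_geomP m : (0 < m)%N -> (1 - fps_qX m) * fps_geom m = 1.
Proof.
move=> m_gt0; apply: fpsP => i.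
have -> : fps_coef ((1 - fps_qX m) * fps_geom m) i =
  fps_coef (fps_geom m) i - fps_coef (fps_qX m * fps_geom m) i.
  by rewrite mulrBl mul1r.
have -> : fps_coef (fps_qX m * fps_geom m) i =
  if (m <= i)%N then (m %| i - m)%:R else 0.
  rewrite /=; case: leqP => [lemi|ltim].
    have lt_m : (m < i.+1)%N by [].
    rewrite (bigD1 (Ordinal lt_m)) //= eqxx mul1r big1 ?addr0 // => j nej.
    case: eqP => [ejm|]; rewrite ?mul0r //.
    by case/eqP: nej; apply: val_inj.
  rewrite big1 // => j _; case: eqP => [ejm|]; rewrite ?mul0r //.
  by move: (ltn_ord j); rewrite ejm ltnS leqNgt ltim.
rewrite /=; case: leqP => [lemi|ltim].
  rewrite -{1}(subnK lemi) dvdn_addl // subrr.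
  by case: eqP lemi => // ->; rewrite leqNgt m_gt0.
rewrite subr0; case: eqP => [->|/eqP]; first by rewrite dvdn0.
by rewrite -lt0n => i_gt0; rewrite gtnNdvd.
Qed.

End FpsRing.

Definition is_intpart (n : nat) (lam : seq nat) : bool :=
  [&& sorted geq lam, 0%N \notin lam & sumn lam == n].

(* The cells of the Young diagram of a partition [lam] of [n], read row by row,
   are numbered by ['I_n]; rows and columns are counted from 0. *)
Definition row_of (lam : seq nat) (a : nat) : nat := reshape_index lam a.
Definition col_of (lam : seq nat) (a : nat) : nat := reshape_offset lam a.

Definition is_ssyt n (lam : seq nat) N (T : {ffun 'I_n -> 'I_N}) : bool :=
  [forall a : 'I_n, forall b : 'I_n,
     ((row_of lam a == row_of lam b) && (col_of lam a < col_of lam b)%N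
        ==> (T a <= T b)%N)
     && ((col_of lam a == col_of lam b) && (row_of lam a < row_of lam b)%N
        ==> (T a < T b)%N)].

(* The Schur function restricted to [N] variables. *)
Definition schur n (lam : seq nat) N : {mpoly rat[N]} :=
  \sum_(T : {ffun 'I_n -> 'I_N} | is_ssyt lam T) \prod_a 'X_(T a).

Definition power_sum N (m : nat) : {mpoly rat[N]} := \sum_(i < N) 'X_i ^+ m.

(* [F], with its variable of index [i] standing for p_{i+1}, is the expansion of
   s_lam in power sums.  An identity between symmetric functions is an identity
   in every finite number [N] of variables.  As s_lam has degree [n], only
   p_1, ..., p_n occur. *)
Definition psum_expansion n (lam : seq nat) (F : {mpoly rat[n]}) : Prop :=
  forall N, F \mPo [tuple power_sum N i.+1 | i < n] = schur n lam N.

(* For a partition [lam] of [n], exactly one [F] satisfies [psum_expansion]. *)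
Definition schur_psum n (lam : seq nat) : {mpoly rat[n]} :=
  xget 0 [set F | psum_expansion lam F]%classic.

(* s_lam[1 / (1 - q)^k] *)
Definition schur_plethysm n k (lam : seq nat) : fps rat :=
  mmap (@fpsC rat) (fun i : 'I_n => fps_geom rat i.+1 ^+ k) (schur_psum n lam).

Section Equivariant.
Variables (F : fieldType) (G : finType) (U V : vectType F).
Variables (rU : G -> 'End(U)) (rV : G -> 'End(V)).

Definition equi_defect (s : G) (f : 'Hom(U, V)) : 'Hom(U, V) :=
  (f \o rU s)%VF - (rV s \o f)%VF.

Definition equiHom : {vspace 'Hom(U, V)} :=
  (\bigcap_(s : G) lker (linfun (equi_defect s)))%VS.

Lemma equi_defect_is_linear s : linear (equi_defect s).
Proof.
move=> c f g; apply/lfunP => u; rewrite /equi_defect.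
rewrite !(add_lfunE, opp_lfunE, scale_lfunE, comp_lfunE) linearP.
by rewrite scalerBr opprD addrACA.
Qed.

HB.instance Definition _ s := GRing.isLinear.Build F 'Hom(U, V) 'Hom(U, V) _
  (equi_defect s) (equi_defect_is_linear s).

Lemma equiHomP (f : 'Hom(U, V)) :
  reflect (forall s u, f (rU s u) = rV s (f u)) (f \in equiHom).
Proof.
apply: (iffP idP) => [| fP].
  rewrite memvE => /subv_bigcapP fP s u.
  have := fP s isT; rewrite -memvE memv_ker lfunE /= /equi_defect subr_eq0.
  by move=> /eqP/lfunP/(_ u); rewrite !comp_lfunE.
rewrite memvE; apply/subv_bigcapP => s _; rewrite -memvE memv_ker lfunE /= /equi_defect subr_eq0.
by apply/eqP/lfunP => u; rewrite !comp_lfunE fP.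
Qed.

End Equivariant.

Lemma equiHom_comp (F : fieldType) (G : finType) (U V W : vectType F)
    (rU : G -> 'End(U)) (rV : G -> 'End(V)) (rW : G -> 'End(W))
    (a : 'Hom(V, W)) (f : 'Hom(U, V)) :
  a \in equiHom rV rW -> f \in equiHom rU rV -> (a \o f)%VF \in equiHom rU rW.
Proof.
move=> /equiHomP aP /equiHomP fP; apply/equiHomP => s u.
by rewrite !comp_lfunE fP aP.
Qed.

(* Composition of permutations as functions, [perm_comp s t i = s (t i)];
   the group law of ['S_n] in MathComp composes in the opposite order. *)
Definition perm_comp n (s t : 'S_n) : 'S_n := (t * s)%g.

Section Specht.
Variables (F : fieldType) (n : nat) (lam : seq nat).

Definition groupalg := {ffun 'S_n -> F^o}.

Definition galg_elt (s : 'S_n) : groupalg := [ffun t => (t == s)%:R].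

Definition galg_lmul_fun (s : 'S_n) (f : groupalg) : groupalg :=
  [ffun t => f (perm_comp s^-1 t)].

Lemma galg_lmul_is_linear s : linear (galg_lmul_fun s).
Proof. by move=> c f g; apply/ffunP => t; rewrite !ffunE. Qed.

HB.instance Definition _ s := GRing.isLinear.Build F groupalg groupalg _
  (galg_lmul_fun s) (galg_lmul_is_linear s).

Definition galg_lmul (s : 'S_n) : 'End(groupalg) := linfun (galg_lmul_fun s).

Lemma galg_lmul_elt s t : galg_lmul s (galg_elt t) = galg_elt (perm_comp s t).
Proof.
rewrite lfunE; apply/ffunP => u; rewrite !ffunE /perm_comp.
by rewrite -(inj_eq (mulIg s)) mulgKV.
Qed.

Lemma galg_lmul_comp s t f :
  galg_lmul s (galg_lmul t f) = galg_lmul (perm_comp s t) f.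
Proof.
rewrite !lfunE; apply/ffunP => u; rewrite !ffunE /perm_comp.
by rewrite invMg mulgA.
Qed.

Definition row_stab (p : 'S_n) : bool :=
  [forall a, row_of lam (p a) == row_of lam a].
Definition col_stab (q : 'S_n) : bool :=
  [forall a, col_of lam (q a) == col_of lam a].

Definition young_symmetrizer : groupalg :=
  \sum_(p | row_stab p) \sum_(q | col_stab q)
     (-1) ^+ q *: galg_elt (perm_comp p q).

(* The left ideal generated by the Young symmetrizer: the irreducible module
   indexed by [lam]. *)
Definition specht : {vspace groupalg} :=
  <<[seq galg_lmul s young_symmetrizer | s : 'S_n]>>%VS.

Lemma specht_stable s f : f \in specht -> galg_lmul s f \in specht.
Proof.
move=> fS; have : galg_lmul s f \in (galg_lmul s @: specht)%VS.
  exact: memv_img.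
rewrite limg_span; apply/subvP/span_subvP => _ /mapP[_ /mapP[t _ ->] ->].
by rewrite galg_lmul_comp; apply: memv_span; apply: map_f; rewrite mem_enum.
Qed.

Definition specht_act (s : 'S_n) : 'End(subvs_of specht) :=
  (linfun (vsproj specht) \o galg_lmul s \o linfun vsval)%VF.

Lemma specht_actE s u : vsval (specht_act s u) = galg_lmul s (vsval u).
Proof.
rewrite !comp_lfunE lfunE [linfun vsval u]lfunE /= vsprojK //.
exact: specht_stable (subvsP u).
Qed.

End Specht.

(* The library makes [dhomog m F r] a vector space only for [m] of the form
   [m'.+1]; the number of variables used here is not syntactically of it. *)
Definition dhomog_dim (m r : nat) : nat :=
  if m is m'.+1 then 'C(r + m', r) else (r == 0)%N.

Lemma dhomog_vecaxiom_all (F : fieldType) (m r : nat) :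
  vector_axiom (dhomog_dim m r) (dhomog m F r).
Proof.
case: m => [|m]; last exact: dhomog_vecaxiom.
pose f (p : dhomog 0 F r) : 'rV[F]_(r == 0)%N := \row_i (val p)@_0%MM.
exists f => [c p q|].
  by apply/rowP => i; rewrite !mxE /= mcoeffD mcoeffZ.
pose g (v : 'rV[F]_(r == 0)%N) : {mpoly F[0]} := \sum_i (v 0 i)%:MP.
have g_homog v : g v \is r.-homog.
  apply: rpred_sum => i _; have /eqP r0 : r == 0%N by case: eqP i => // _ [].
  rewrite -alg_mpolyC; apply: rpredZ.
  have h d : d = 0%N -> (1 : {mpoly F[0]}) \is d.-homog.
    by move=> ->; exact: dhomog1.
  exact: h.
exists (fun v => DHomog (g_homog v)) => [p | v].
  apply/val_inj/mpolyP => m; have -> : m = 0%MM by apply/mnmP => -[].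
  rewrite /= /g raddf_sum /=.
  under eq_bigr do rewrite mcoeffC eqxx mulr1 mxE.
  rewrite sumr_const card_ord; case: eqP => [//|/eqP r_neq0].
  rewrite mulr0n (dhomog_nemf_coeff (valP p)) //.
  by rewrite /= mdeg0 eq_sym.
apply/rowP => i; rewrite mxE /= /g raddf_sum /=.
under eq_bigr do rewrite mcoeffC eqxx mulr1.
rewrite (bigD1 i) //= big1 ?addr0 // => j; case/eqP; apply: val_inj.
by case: eqP i j => _ [[|//] ?] [[|//] ?].
Qed.

Section Polynomials.
Variables (F : fieldType) (r k n : nat).

(* The variable x_{ij} is ['X_(enum_rank (i, j))]. *)
Notation nvars := #|{: 'I_n * 'I_k}|.

Definition homog_poly := dhomog nvars F r.

HB.instance Definition _ := GRing.Lmodule.on homog_poly.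
HB.instance Definition _ := SubType.on homog_poly.

Definition xvar (i : 'I_n) (j : 'I_k) : {mpoly F[nvars]} :=
  'X_(enum_rank (i, j)).

Definition mpoly_act (s : 'S_n) (p : {mpoly F[nvars]}) : {mpoly F[nvars]} :=
  p \mPo [tuple xvar (s (enum_val l).1) (enum_val l).2 | l < nvars].

Lemma mpoly_act_xvar s i j : mpoly_act s (xvar i j) = xvar (s i) j.
Proof.
by rewrite /mpoly_act comp_mpolyXU -tnth_nth tnth_mktuple enum_rankK.
Qed.

Lemma mpoly_act_homog s p : p \is r.-homog -> mpoly_act s p \is r.-homog.
Proof.
move=> /dhomogP homp; rewrite /mpoly_act comp_mpolyEX big_seq.
apply: rpred_sum => m /homp /= <-; apply: rpredZ; rewrite comp_mpolyX mdegE.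
elim/big_rec2: _ => [|l d q _ homq]; first exact: dhomog1.
apply: dhomogM => //; rewrite tnth_mktuple -[X in X.-homog]mul1n.
by apply: dhomogMn; rewrite dhomogX; apply/eqP/mdeg1.
Qed.

Lemma mpoly_act_comp s t p :
  mpoly_act s (mpoly_act t p) = mpoly_act (perm_comp s t) p.
Proof.
rewrite /mpoly_act (comp_mpolyEX p) (comp_mpolyEX p) raddf_sum /=.
apply: eq_bigr => m _; rewrite comp_mpolyZ; congr (_ *: _).
rewrite !comp_mpolyX rmorph_prod /=; apply: eq_bigr => l _.
rewrite rmorphXn /= !tnth_mktuple -/(mpoly_act s _) mpoly_act_xvar.
by rewrite /perm_comp permM.
Qed.

Lemma homog_poly_vecaxiom :
  vector_axiom (dhomog_dim nvars r) homog_poly.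
Proof. exact: dhomog_vecaxiom_all. Qed.

HB.instance Definition _ :=
  Lmodule_hasFinDim.Build F homog_poly homog_poly_vecaxiom.

Definition poly_act_fun (s : 'S_n) (p : homog_poly) : homog_poly :=
  DHomog (mpoly_act_homog s (valP p)).

Lemma poly_act_is_linear s : linear (poly_act_fun s).
Proof.
move=> c p q; apply: val_inj; rewrite /= /mpoly_act.
by rewrite comp_mpolyD comp_mpolyZ.
Qed.

HB.instance Definition _ s := GRing.isLinear.Build F homog_poly homog_poly _
  (poly_act_fun s) (poly_act_is_linear s).

Definition poly_act (s : 'S_n) : 'End(homog_poly) := linfun (poly_act_fun s).

Lemma poly_actE s (p : homog_poly) :
  mpoly_of_dhomog (poly_act s p) = mpoly_act s (mpoly_of_dhomog p).
Proof. by rewrite lfunE. Qed.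

(* A_{r,k}(n) = End_{F S_n}(P^r(V_{n,k})) *)
Definition centralizer : {vspace 'End(homog_poly)} := equiHom poly_act poly_act.

(* Hom_{F S_n}(W^lam, P^r(V_{n,k})), on which A_{r,k}(n) acts by
   post-composition, see [cent_module_stable]. *)
Definition cent_module (lam : seq nat) :
    {vspace 'Hom(subvs_of (specht F n lam), homog_poly)} :=
  equiHom (@specht_act F n lam) poly_act.

Lemma cent_module_stable lam a f :
  a \in centralizer -> f \in cent_module lam -> (a \o f)%VF \in cent_module lam.
Proof. exact: equiHom_comp. Qed.

End Polynomials.

Definition tsum (k d : nat) : nat :=
  (\sum_(0 <= e < d) 'C((k + e).-1, e))%N.

(* The outer sum is cut off at [J]; its terms with [size lam < j] vanish, see
   [deg_sum_stable]. *)
Definition deg_sum (k : nat) (lam : seq nat) (J : nat) : nat :=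
  (\sum_(1 <= j < J.+1) j.-1 *
     \sum_((tsum k j.-1).+1 <= i < (tsum k j).+1) nth 0 lam i.-1)%N.

Definition deg_bound (k : nat) (lam : seq nat) : nat :=
  deg_sum k lam (size lam).

Lemma deg_sum_stable k lam J :
  (0 < k)%N -> (size lam <= J)%N -> deg_sum k lam J = deg_bound k lam.
Proof.
move=> k_gt0 leJ; rewrite /deg_bound /deg_sum.
rewrite (@big_cat_nat _ _ _ (size lam).+1) //= [X in (_ + X)%N]big_nat.
rewrite [X in (_ + X)%N]big1 ?addn0 // => j /andP[ltj _].
rewrite [X in (_ * X)%N]big_nat big1 ?muln0 // => i /andP[lti _].
apply: nth_default; case: j i ltj lti => [|j] [|i] //= ltj lti.
rewrite ltnS in ltj; rewrite ltnS in lti.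
apply: leq_trans ltj (leq_trans _ lti).
rewrite /tsum -[X in (X <= _)%N](subn0 j) -[X in (X <= _)%N]muln1.
rewrite -sum_nat_const_nat big_nat [X in (_ <= X)%N]big_nat.
apply: leq_sum => e _; rewrite bin_gt0.
by rewrite -(prednK k_gt0) addSn leq_addl.
Qed.

(* Main.v *)
(* Fillings T of the cells of lam by ordered letters span permutation modules M
   of S_n, and for the Young symmetrizer c = a b the image c M has a basis
   indexed by the semistandard fillings of M: Garnir relations straighten c T,
   and an order on row-equivalence classes makes the semistandard vectors c T
   triangular. By Maschke there is u with c u c = c, so Hom(A c, M) = c M for
   A = C S_n.

   Over the monomial basis of P^r(V_{n,k}), a letter is a monomial in k
   variables, and a filling lies in P^r when its letters have total degree r;
   hence the dimension is the number of semistandard fillings of total degree r.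
   The trace of the idempotent c u on M counts semistandard fillings by fixed
   points of permutations; summed over the weights this is the power-sum
   expansion of s_lam, and substituting q^deg for each letter identifies the
   coefficient of q^r with the same number. Finally, a column-strict filling has
   letters of index at least i in row i, so its smallest degree is the bound in
   the statement, and any larger degree is reached by raising the last cell of
   the last row. *)
Require Import Defs.
From HB Require Import structures.
From mathcomp Require Import all_boot all_order all_algebra all_fingroup.
From mathcomp Require Import reals complex.
From mathcomp Require Import mpoly zify ring.

Set Implicit Arguments.
Unset Strict Implicit.
Unset Printing Implicit Defensive.

Import GRing.Theory Num.Theory Order.TTheory.
Local Open Scope ring_scope.

(** * Straightening of fillings *)

Section YoungDiagram.
Variables (n : nat) (lam : seq nat).
Hypothesis lam_n : is_intpart n lam.
Local Notation row := (row_of lam).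
Local Notation col := (col_of lam).

Lemma sumn_intpart : sumn lam = n.
Proof. by case/and3P: lam_n => _ _ /eqP. Qed.

Lemma row_of_lt_size (a : 'I_n) : (row a < size lam)%N.
Proof. by apply: reshape_indexP; rewrite sumn_intpart. Qed.

Lemma col_of_lt_nth (a : 'I_n) : (col a < nth 0%N lam (row a))%N.
Proof. by apply: reshape_offsetP; rewrite sumn_intpart. Qed.

Lemma cell_inj (a b : 'I_n) : row a = row b -> col a = col b -> a = b.
Proof.
move=> er ec; apply: val_inj.
by rewrite /= -[LHS](reshape_indexK lam) -[RHS](reshape_indexK lam) -/(row a)
  -/(row b) -/(col a) -/(col b) er ec.
Qed.

Lemma nth_intpart_anti i j : (i <= j)%N -> (nth 0 lam j <= nth 0 lam i)%N.
Proof.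
move=> leij; have [ltj|lej] := ltnP j (size lam); last by rewrite nth_default.
case/and3P: lam_n => lam_s _ _.
apply: (sorted_leq_nth (rev_trans leq_trans) _ 0%N lam_s) => //.
exact: leq_ltn_trans ltj.
Qed.

Lemma exists_cell i j :
  (j < nth 0 lam i)%N -> exists b : 'I_n, row b = i /\ col b = j.
Proof.
move=> ltj; have lt_n : (flatten_index lam i j < n)%N.
  by rewrite -sumn_intpart; apply: flatten_indexP.
exists (Ordinal lt_n); rewrite /row_of /col_of /=.
by rewrite flatten_indexKl // flatten_indexKr.
Qed.

Lemma diagram_down_closed (a : 'I_n) i j : (i <= row a)%N -> (j <= col a)%N ->
  exists b : 'I_n, row b = i /\ col b = j.
Proof.
move=> lei lej; apply: exists_cell; apply: leq_ltn_trans lej _.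
exact: leq_trans (col_of_lt_nth a) (nth_intpart_anti lei).
Qed.

End YoungDiagram.

Section Fillings.
Variables (n N : nat).
Implicit Types (s t : 'S_n) (T : {ffun 'I_n -> 'I_N}).

Definition fill_act s T : {ffun 'I_n -> 'I_N} := [ffun i => T ((s^-1)%g i)].

Lemma fill_actM s t T : fill_act (s * t)%g T = fill_act t (fill_act s T).
Proof. by apply/ffunP => i; rewrite !ffunE invMg permM. Qed.

Lemma fill_act1 T : fill_act 1%g T = T.
Proof. by apply/ffunP => i; rewrite ffunE invg1 perm1. Qed.

Lemma fill_act_inj s : injective (fill_act s).
Proof.
by apply: can_inj (fill_act s^-1) _ => T; rewrite -fill_actM mulgV fill_act1.
Qed.

Lemma sum_fill_act s T (f : 'I_n -> nat) :
  (\sum_c fill_act s T c * f c = \sum_c T c * f (s c))%N.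
Proof.
rewrite [LHS](reindex_inj (@perm_inj _ s)) /=.
by apply: eq_bigr => c _; rewrite ffunE permK.
Qed.

Lemma fill_act_tperm x y T : T x = T y -> fill_act (tperm x y) T = T.
Proof. by move=> e; apply/ffunP => i; rewrite ffunE tpermV; case: tpermP => [->|->|]. Qed.

End Fillings.

Section Stabilizers.
Variables (n : nat) (lam : seq nat).
Implicit Types s t : 'S_n.

Lemma row_stabP s : reflect (forall a, row_of lam (s a) = row_of lam a) (row_stab lam s).
Proof. by apply: (iffP forallP) => h a; apply/eqP. Qed.

Lemma col_stabP s : reflect (forall a, col_of lam (s a) = col_of lam a) (col_stab lam s).
Proof. by apply: (iffP forallP) => h a; apply/eqP. Qed.

Lemma row_stabMl s t : row_stab lam s -> row_stab lam (s * t)%g = row_stab lam t.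
Proof.
move/row_stabP => hs; apply/row_stabP/row_stabP => h a.
  by rewrite -(permKV s a) -permM h hs.
by rewrite permM h hs.
Qed.

Lemma col_stabMl s t : col_stab lam s -> col_stab lam (s * t)%g = col_stab lam t.
Proof.
move/col_stabP => hs; apply/col_stabP/col_stabP => h a.
  by rewrite -(permKV s a) -permM h hs.
by rewrite permM h hs.
Qed.

Lemma row_stab1 : row_stab lam (1 : 'S_n)%g.
Proof. by apply/row_stabP => a; rewrite perm1. Qed.

Lemma col_stab1 : col_stab lam (1 : 'S_n)%g.
Proof. by apply/col_stabP => a; rewrite perm1. Qed.

Lemma row_stab_tperm (x y : 'I_n) : row_of lam x = row_of lam y -> row_stab lam (tperm x y).
Proof. by move=> e; apply/row_stabP => a; case: tpermP => // ->. Qed.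

Lemma col_stab_tperm (x y : 'I_n) : col_of lam x = col_of lam y -> col_stab lam (tperm x y).
Proof. by move=> e; apply/col_stabP => a; case: tpermP => // ->. Qed.

End Stabilizers.

Section YoungVector.
Variables (F : numFieldType) (V : vectType F) (n N : nat) (lam : seq nat).
Hypothesis lam_n : is_intpart n lam.
Variable v : {ffun 'I_n -> 'I_N} -> V.
Implicit Types (s t p q : 'S_n) (T : {ffun 'I_n -> 'I_N}).
Local Notation row := (row_of lam).
Local Notation col := (col_of lam).

Definition young_vec T : V :=
  \sum_(p | row_stab lam p) \sum_(q | col_stab lam q)
     (-1) ^+ q *: v (fill_act p (fill_act q T)).

Lemma young_vec_col s T : col_stab lam s ->
  young_vec (fill_act s T) = (-1) ^+ s *: young_vec T.
Proof.
move=> sC; rewrite /young_vec scaler_sumr; apply: eq_bigr => p _.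
rewrite [in RHS](reindex_inj (mulgI s)) /= scaler_sumr.
apply: eq_big => [q|q _]; first by rewrite col_stabMl.
by rewrite scalerA odd_permM signr_addb signrMK fill_actM.
Qed.

Lemma eq_opp_eq0 (x : V) : x = - x -> x = 0.
Proof.
move=> e; apply/eqP; have /eqP : 2%:R *: x = 0.
  by rewrite scaler_nat mulr2n {1}e addNr.
by rewrite scaler_eq0 pnatr_eq0.
Qed.

Lemma young_vec_repeat T (x y : 'I_n) :
  x != y -> col x = col y -> T x = T y -> young_vec T = 0.
Proof.
move=> nexy ec eT; apply: eq_opp_eq0.
rewrite -{1}(fill_act_tperm eT) young_vec_col ?col_stab_tperm //.
by rewrite odd_tperm nexy scaleN1r.
Qed.

(* Each [q] in the column stabilizer sends two cells of [D] to one row; the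
   transposition of these two cells changes the sign of the sum and can be
   absorbed by the row stabilizer. *)
Lemma garnir_relation (D : {set 'I_n}) T :
  (forall q, col_stab lam q -> exists x y : 'I_n,
     [/\ x \in D, y \in D, x != y & row (q x) = row (q y)]) ->
  \sum_(s | perm_on D s) (-1) ^+ s *: young_vec (fill_act s T) = 0.
Proof.
move=> hD; rewrite /young_vec.
under eq_bigr => s _.
  rewrite exchange_big /= scaler_sumr; under eq_bigr do rewrite scaler_sumr.
  over.
rewrite exchange_big /= big1 // => q qC.
have [x [y [xD yD nexy er]]] := hD q qC.
apply: eq_opp_eq0.
rewrite [LHS](reindex_inj (mulIg (tperm x y))) -sumrN.
apply: eq_big => s.
  have tD : perm_on D (tperm x y).
    apply/subsetP => z; rewrite inE.
    by case: tpermP => [->|->|] //; rewrite eqxx.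
  apply/idP/idP => hs; last exact: perm_onM.
  by rewrite -(mulgK (tperm x y) s) tpermV; apply: perm_onM.
move=> _; rewrite (reindex_inj (mulgI (tperm (q x) (q y)))) -sumrN.
apply: eq_big => p; first by rewrite row_stabMl ?row_stab_tperm.
move=> _; rewrite odd_permM odd_tperm nexy addbT signrN scaleNr; congr (- _).
by rewrite -!fill_actM -tpermJ (mulgA q) -conjgC !mulgA -(mulgA s) tperm2 mulg1.
Qed.

Definition col_weight T : nat := \sum_c T c * col c.
Definition row_weight T : nat := \sum_c T c * row c.

Definition column_strict T := forall x y : 'I_n,
  col x = col y -> (row x < row y)%N -> (T x < T y)%N.

Section Violation.
Variables (T : {ffun 'I_n -> 'I_N}) (a b : 'I_n).
Hypotheses (T_col : column_strict T) (row_ab : row a = row b)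
  (lt_col : (col a < col b)%N) (lt_ba : (T b < T a)%N).

Let A := [set c : 'I_n | (col c == col a) && (row a <= row c)%N].
Let B := [set c : 'I_n | (col c == col b) && (row c <= row b)%N].

Lemma column_strict_ge_a c : c \in A -> (T a <= T c)%N.
Proof.
rewrite inE => /andP[/eqP ec]; rewrite leq_eqVlt => /predU1P[er|lt].
  by rewrite (cell_inj er (esym ec)).
by apply/ltnW/T_col.
Qed.

Lemma column_strict_le_b c : c \in B -> (T c <= T b)%N.
Proof.
rewrite inE => /andP[/eqP ec]; rewrite leq_eqVlt => /predU1P[er|lt].
  by rewrite (cell_inj er ec).
by apply/ltnW/T_col.
Qed.

Lemma garnir_perm_lt s : perm_on (A :|: B) s -> ~~ col_stab lam s ->
  (col_weight T < col_weight (fill_act s T))%N.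
Proof.
move=> sD nC.
(* The threshold T b + 1/2 separates the letters of [B] from those of [A]. *)
pose term (c : 'I_n) : int :=
  (2%:Z * (T c)%:Z - (2 * T b + 1)%:Z) * ((col (s c))%:Z - (col c)%:Z).
suff : 0 < \sum_c term c.
  rewrite /col_weight sum_fill_act.
  have -> : \sum_c term c =
     2%:Z * ((\sum_c T c * col (s c))%N%:Z - (\sum_c T c * col c)%N%:Z)
     - (2 * T b + 1)%:Z * (\sum_(c : 'I_n) (col (s c))%:Z - \sum_(c : 'I_n) (col c)%:Z).
    rewrite !(big_morph Posz PoszD (erefl _)).
    rewrite -!sumrB !mulr_sumr -sumrB; apply: eq_bigr => c _.
    rewrite /term !PoszM; ring.
  have <- : \sum_(c : 'I_n) (col (s c))%:Z = \sum_(c : 'I_n) (col c)%:Z.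
    by rewrite [RHS](reindex_inj (@perm_inj _ s)).
  by rewrite subrr mulr0; lia.
have in_D c : s c != c -> (s c \in A :|: B) /\ (c \in A :|: B).
  move=> ne; have cD : c \in A :|: B by apply: contraR ne => /(out_perm sD) ->.
  by rewrite (perm_closed _ sD).
have term_gt0 c : col (s c) != col c -> 0 < term c.
  rewrite /term => ne; have [|scD cD] := in_D c; first by apply: contraNneq ne => ->.
  move: scD cD; rewrite !in_setU => /orP[scD|scD] /orP[cD|cD].
  - move: ne scD cD; rewrite !inE => /eqP ne /andP[/eqP e1 _] /andP[/eqP e2 _].
    by case: ne; rewrite e1.
  - have := column_strict_le_b cD.
    move: scD cD; rewrite !inE => /andP[/eqP -> _] /andP[/eqP -> _].
    by move=> le; rewrite nmulr_rgt0; lia.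
  - have := column_strict_ge_a cD.
    move: scD cD; rewrite !inE => /andP[/eqP -> _] /andP[/eqP -> _].
    by move=> le; rewrite pmulr_rgt0; lia.
  - move: ne scD cD; rewrite !inE => /eqP ne /andP[/eqP e1 _] /andP[/eqP e2 _].
    by case: ne; rewrite e1.
have /existsP[c0 c0P] : [exists c, col (s c) != col c] by rewrite -negb_forall.
rewrite (bigD1 c0) //=; apply: ltr_pwDl; first exact: term_gt0.
apply: sumr_ge0 => c _; have [e|/term_gt0/ltW //] := eqVneq (col (s c)) (col c).
by rewrite /term e subrr mulr0.
Qed.

Lemma garnir_pigeonhole q : col_stab lam q -> exists x y : 'I_n,
  [/\ x \in A :|: B, y \in A :|: B, x != y & row (q x) = row (q y)].
Proof.
move=> /col_stabP qC; pose C := [set c : 'I_n | col c == col a].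
pose proj (j : nat) (c : 'I_n) :=
  odflt c [pick d : 'I_n | (row d == row c) && (col d == j)].
have projP (c : 'I_n) j : (exists d : 'I_n, row d = row c /\ col d = j) ->
  row (proj j c) = row c /\ col (proj j c) = j.
  case=> d [e1 e2]; rewrite /proj; case: pickP => [d'|/(_ d)].
    by case/andP => /eqP ? /eqP ?.
  by rewrite e1 e2 !eqxx.
have toC c : c \in A :|: B ->
  row (proj (col a) (q c)) = row (q c) /\ col (proj (col a) (q c)) = col a.
  move=> cD; apply: projP; apply: (diagram_down_closed lam_n) => //.
  by move: cD; rewrite qC !inE => /orP[/andP[/eqP ->]|/andP[/eqP -> _]] //; apply: ltnW.
have toB c : c \in C :\: A -> row (proj (col b) c) = row c /\ col (proj (col b) c) = col b.
  rewrite !inE => /andP[nA ec]; apply: projP; apply: (diagram_down_closed lam_n) (leqnn _).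
  by move: nA; rewrite ec /= -ltnNge -row_ab => /ltnW.
have [inj|] := boolP [forall x in A :|: B, forall y in A :|: B,
    (row (q x) == row (q y)) ==> (x == y)].
  have le1 : (#|A :|: B| <= #|C|)%N.
    rewrite -(card_in_imset (f := fun c => proj (col a) (q c))).
      apply/subset_leq_card/subsetP => _ /imsetP[c cD ->].
      by rewrite inE (toC _ cD).2.
    move=> x y xD yD e; have /forall_inP/(_ y yD)/implyP := forall_inP inj x xD.
    by rewrite -(toC _ xD).1 -(toC _ yD).1 e eqxx => /(_ isT)/eqP.
  have le2 : (#|C :\: A| <= #|B :\ b|)%N.
    rewrite -(card_in_imset (f := proj (col b))).
      apply/subset_leq_card/subsetP => _ /imsetP[c cD ->].
      have [er ec] := toB c cD; move: cD; rewrite !inE er ec eqxx.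
      case/andP => nA eca; move: nA; rewrite eca /= -ltnNge row_ab => lt.
      rewrite ltnW ?andbT //; apply/eqP => e; move: lt.
      by rewrite -er e ltnn.
    move=> x y xD yD e; apply: (@cell_inj _ lam).
      by rewrite -(toB _ xD).1 -(toB _ yD).1 e.
    by move: xD yD; rewrite !inE => /andP[_ /eqP ->] /andP[_ /eqP ->].
  have bB : b \in B by rewrite inE eqxx leqnn.
  have disj : A :&: B = set0.
    apply/setP => c; rewrite !inE; apply/negP => /andP[/andP[/eqP e1 _] /andP[/eqP e2 _]].
    by move: lt_col; rewrite -e1 -e2 ltnn.
  have subAC : A \subset C by apply/subsetP => c; rewrite !inE => /andP[].
  have := cardsU A B; have := cardsD C A; rewrite (setIidPr subAC) disj cards0.
  have := cardsD1 b B; rewrite bB; have := subset_leq_card subAC.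
  by move=> h1 h2 h3 h4; exfalso; lia.
case/forall_inPn => x xD /forall_inPn[y yD]; rewrite negb_imply => /andP[/eqP er ne].
by exists x, y.
Qed.

Lemma young_vec_violation (W : {vspace V}) :
  (forall s, (col_weight T < col_weight (fill_act s T))%N ->
     young_vec (fill_act s T) \in W) -> young_vec T \in W.
Proof.
move=> hW; have := garnir_relation T garnir_pigeonhole.
rewrite (bigID (@col_stab n lam)) /= (eq_bigr (fun=> young_vec T)); last first.
  by move=> s /andP[_ sC]; rewrite young_vec_col // signrZK.
rewrite sumr_const => /eqP; rewrite addr_eq0 => /eqP e.
set m := #|_| in e; have m_gt0 : (0 < m)%N.
  by apply/card_gt0P; exists 1%g; rewrite unfold_in /= perm_on1 col_stab1.
have : young_vec T *+ m \in W.
  rewrite e rpredN; apply: rpred_sum => s /andP[sD nC].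
  by apply/rpredZ/hW/garnir_perm_lt.
by rewrite -scaler_nat rpredZeq pnatr_eq0 -[m == 0]negbK -lt0n m_gt0.
Qed.

End Violation.
End YoungVector.

(** * The semistandard basis *)

Section FillingOrder.
Variables (n N : nat) (lam : seq nat).
Implicit Types (s p q : 'S_n) (T U : {ffun 'I_n -> 'I_N}).
Local Notation row := (row_of lam).
Local Notation col := (col_of lam).

Lemma is_ssytP T : reflect
  ((forall x y : 'I_n, row x = row y -> (col x < col y)%N -> (T x <= T y)%N) /\
   column_strict lam T) (is_ssyt lam T).
Proof.
apply: (iffP idP) => [/'forall_forallP h|[h1 h2]].
  split=> x y e lt; have /andP[/implyP h1 /implyP h2] := h x y.
    by apply: h1; rewrite e eqxx.
  by apply: h2; rewrite e eqxx.
apply/'forall_forallP => x y; apply/andP; split; apply/implyP => /andP[/eqP e lt].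
  exact: h1.
exact: h2.
Qed.

Lemma fill_act_sorted_eq (cls key : 'I_n -> nat) s T :
  (forall c, cls (s c) = cls c) ->
  (forall x y, cls x = cls y -> key x = key y -> x = y) ->
  (forall x y, cls x = cls y -> (key x < key y)%N -> (T x <= T y)%N) ->
  (forall x y, cls x = cls y -> (key x < key y)%N ->
     (fill_act s T x <= fill_act s T y)%N) ->
  fill_act s T = T.
Proof.
move=> s_cls key_inj T_le sT_le.
pose D U c t := [set x | (cls x == cls c) && (U x <= t)%N].
have eqD c t : D (fill_act s T) c t = D T c t.
  have D_sub U1 U2 : (forall x y, cls x = cls y -> (key x < key y)%N -> (U2 x <= U2 y)%N) ->
      (forall x y, cls x = cls y -> (key x < key y)%N -> (U1 x <= U1 y)%N) ->
      #|D U1 c t| = #|D U2 c t| -> D U1 c t \subset D U2 c t.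
    move=> h2 h1 ec; apply/negPn/negP => /subsetPn[x]; rewrite !inE => /andP[/eqP cx le1].
    rewrite cx eqxx /= -ltnNge => lt2.
    have : D U2 c t \proper D U1 c t.
      apply/properP; split; last by exists x; rewrite !inE cx eqxx //= -ltnNge.
      apply/subsetP => y; rewrite !inE => /andP[/eqP cy le2]; rewrite cy eqxx /=.
      have ec' : cls y = cls x by rewrite cx.
      case: (ltngtP (key y) (key x)) => [lt|lt|e].
      - exact: leq_trans (h1 _ _ ec' lt) le1.
      - by have := leq_trans (h2 _ _ (esym ec') lt) le2; rewrite leqNgt lt2.
      - by rewrite (key_inj _ _ ec' e).
    by move/proper_card; rewrite ec ltnn.
  have ecard : #|D (fill_act s T) c t| = #|D T c t|.
    rewrite -[RHS](card_imset _ (@perm_inj _ s)); apply: eq_card => x; rewrite inE.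
    apply/andP/imsetP => [[/eqP cx le]|[y]].
      exists ((s^-1)%g x); rewrite ?permKV // inE -(s_cls ((s^-1)%g x)) permKV cx eqxx.
      by move: le; rewrite ffunE.
    by rewrite inE => /andP[/eqP cy le] ->; rewrite s_cls cy eqxx ffunE permK.
  by apply/eqP; rewrite eqEsubset !D_sub.
apply/ffunP => c; apply: val_inj; apply/eqP; rewrite eqn_leq; apply/andP; split.
  by have := eqD c (T c) => /setP/(_ c); rewrite !inE eqxx leqnn.
by have := eqD c (fill_act s T c) => /setP/(_ c); rewrite !inE eqxx leqnn /= => <-.
Qed.

Lemma row_weight_row p T : row_stab lam p ->
  row_weight lam (fill_act p T) = row_weight lam T.
Proof.
move=> /row_stabP pR; rewrite /row_weight sum_fill_act.
by apply: eq_bigr => c _; rewrite pR.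
Qed.

Lemma row_weight_swap T (x y : 'I_n) : (row x < row y)%N -> (T y < T x)%N ->
  (row_weight lam T < row_weight lam (fill_act (tperm x y) T))%N.
Proof.
move=> ltr ltT; have nexy : y != x by apply: contraTneq ltr => ->; rewrite ltnn.
rewrite /row_weight sum_fill_act.
rewrite [ltnLHS](bigD1 x) // [ltnRHS](bigD1 x) //= [ltnLHS]addnC [ltnRHS]addnC.
rewrite [X in (X + _ < _)%N](bigD1 y) // [X in (_ < X + _)%N](bigD1 y) //= tpermL tpermR.
rewrite [X in (_ < _ + X + _)%N](eq_bigr (fun c => T c * row c)%N).
  have : (T y * row y + T x * row x < T y * row x + T x * row y)%N by nia.
  by move=> h; rewrite [ltnLHS]addnAC [ltnRHS]addnAC ltn_add2r.
by move=> c /andP[cx cy]; rewrite tpermD // eq_sym.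
Qed.

Lemma column_strict_inj T (x y : 'I_n) : is_intpart n lam ->
  column_strict lam T -> col x = col y -> T x = T y -> x = y.
Proof.
move=> lam_n T_col ec eT; apply: (cell_inj _ ec).
by case: (ltngtP (row x) (row y)) => // lt;
   have := T_col _ _ _ lt; rewrite ec eT ltnn => /(_ erefl).
Qed.

Lemma row_weight_col q T : is_intpart n lam -> column_strict lam T -> col_stab lam q ->
  (row_weight lam (fill_act q T) <= row_weight lam T)%N /\
  (row_weight lam (fill_act q T) = row_weight lam T -> q = 1%g).
Proof.
move=> lam_n T_col qC.
have max_eq1 s : col_stab lam s ->
  (forall s', col_stab lam s' ->
     (row_weight lam (fill_act s' T) <= row_weight lam (fill_act s T))%N) ->
  s = 1%g.
  move=> sC s_max; have /col_stabP sc := sC.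
  have sT_eq : fill_act s T = T.
    apply: (@fill_act_sorted_eq col row) => // [x y ec er|x y ec lt|x y ec lt].
    - exact: (cell_inj er).
    - by apply/ltnW/T_col.
    rewrite leqNgt; apply/negP => ltT.
    have := s_max (s * tperm x y)%g; rewrite col_stabMl // col_stab_tperm // => /(_ isT).
    by rewrite fill_actM leqNgt row_weight_swap.
  apply/permP => c; rewrite perm1; apply: (column_strict_inj lam_n T_col); first exact: sc.
  by rewrite -[in LHS]sT_eq ffunE permK.
have [q0 q0C q0_max] :=
  arg_maxnP (fun s => row_weight lam (fill_act s T)) (@col_stab1 n lam).
have q01 : q0 = 1%g by apply: max_eq1.
move: q0_max; rewrite q01 fill_act1 => q0_max; split; first exact: q0_max.
by move=> e; apply: max_eq1 => // s' s'C; rewrite e; apply: q0_max.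
Qed.

Lemma is_ssyt_row_eq p T : is_intpart n lam -> row_stab lam p ->
  is_ssyt lam T -> is_ssyt lam (fill_act p T) -> fill_act p T = T.
Proof.
move=> lam_n /row_stabP pR /is_ssytP[T_row _] /is_ssytP[pT_row _].
by apply: (@fill_act_sorted_eq row col) => // x y er ec; apply: (cell_inj er ec).
Qed.

End FillingOrder.

Section YoungBasis.
Variables (F : numFieldType) (V : vectType F) (n N : nat) (lam : seq nat).
Hypothesis lam_n : is_intpart n lam.
Variables (v : {ffun 'I_n -> 'I_N} -> V) (X : pred {ffun 'I_n -> 'I_N}).
Hypothesis X_stable : forall s T, X T -> X (fill_act s T).
Local Notation row := (row_of lam).
Local Notation col := (col_of lam).
Local Notation young_vec := (young_vec lam v).

Definition ssyt_in : pred {ffun 'I_n -> 'I_N} := [pred T | X T & is_ssyt lam T].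

(* Both straightening steps raise [mu]: Garnir relations raise [col_weight], and
   sorting a column keeps it while raising [row_weight]. *)
Lemma young_vec_span T : X T ->
  young_vec T \in <<[seq young_vec U | U <- enum ssyt_in]>>%VS.
Proof.
pose K := (\max_(T : {ffun 'I_n -> 'I_N}) row_weight lam T).+1.
pose mu (T : {ffun 'I_n -> 'I_N}) := (K * col_weight lam T + row_weight lam T)%N.
pose m := \max_T mu T.
have mu_col U U' : (col_weight lam U < col_weight lam U')%N -> (mu U < mu U')%N.
  move=> lt; have := leq_bigmax (F := row_weight lam) U.
  by rewrite -ltnS -/K /mu => ltK; nia.
have [d] := ubnP (m - mu T); elim: d T => // d IH T; rewrite ltnS => led XT.
have {}IH U : X U -> (mu T < mu U)%N ->
    young_vec U \in <<[seq young_vec U | U <- enum ssyt_in]>>%VS.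
  move=> XU lt; apply: IH => //; apply: leq_trans led.
  by have := leq_bigmax (F := mu) U; rewrite -/m; lia.
have [T_ssyt|nT] := boolP (is_ssyt lam T).
  by apply/memv_span/map_f; rewrite mem_enum inE /= XT.
have [/existsP[x /existsP[y /and3P[/eqP ec ltr leT]]]|T_col] :=
  boolP [exists x : 'I_n, exists y : 'I_n,
    [&& col x == col y, (row x < row y)%N & (T y <= T x)%N]].
  have nexy : x != y by apply: contraTneq ltr => ->; rewrite ltnn.
  move: leT; rewrite leq_eqVlt => /predU1P[eT|ltT].
    by rewrite (young_vec_repeat _ nexy ec) ?mem0v //; apply: val_inj.
  rewrite -memvN -scaleN1r; have := young_vec_col v T (col_stab_tperm ec).
  rewrite odd_tperm nexy expr1 => <-.
  apply: IH; first exact: X_stable.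
  rewrite /mu; have -> : col_weight lam (fill_act (tperm x y) T) = col_weight lam T.
    rewrite /col_weight sum_fill_act; apply: eq_bigr => c _.
    by have /col_stabP -> := col_stab_tperm ec.
  by rewrite ltn_add2l row_weight_swap.
have {}T_col : column_strict lam T.
  move=> x y ec lt; rewrite ltnNge; apply: contra T_col => le.
  by apply/existsP; exists x; apply/existsP; exists y; rewrite ec eqxx lt.
have [/existsP[x /existsP[y /and3P[/eqP er ltc ltT]]]|T_row] :=
  boolP [exists x : 'I_n, exists y : 'I_n,
    [&& row x == row y, (col x < col y)%N & (T y < T x)%N]].
  apply: (young_vec_violation lam_n T_col er ltc ltT) => s lt.
  by apply: IH; [exact: X_stable | exact: mu_col].
case/negP: nT; apply/is_ssytP; split=> // x y er lt; rewrite leqNgt.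
apply: contra T_row => lt'.
by apply/existsP; exists x; apply/existsP; exists y; rewrite er eqxx lt.
Qed.

Variable co : {ffun 'I_n -> 'I_N} -> {scalar V}.
Hypothesis co_v : forall T U, X T -> X U -> co T (v U) = (T == U)%:R.

Lemma co_sum T (I : finType) (P : pred I) (a : I -> F) (f : I -> V) :
  co T (\sum_(i | P i) a i *: f i) = \sum_(i | P i) a i * co T (f i).
Proof. by rewrite raddf_sum; apply: eq_bigr => i _; apply: scalarZ. Qed.

Lemma co_young_vec T U : X T -> X U -> co T (young_vec U) =
  \sum_(p | row_stab lam p) \sum_(q | col_stab lam q)
     (-1) ^+ q * (T == fill_act p (fill_act q U))%:R.
Proof.
move=> XT XU; rewrite raddf_sum; apply: eq_bigr => p _; rewrite /= co_sum.
by apply: eq_bigr => q _; rewrite co_v //; do 2!apply: X_stable.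
Qed.

Lemma co_young_vec_neq0 T U : X T -> X U -> is_ssyt lam T -> is_ssyt lam U ->
  co T (young_vec U) != 0 -> (row_weight lam U <= row_weight lam T)%N -> T = U.
Proof.
move=> XT XU Ts Us; rewrite co_young_vec // => ne0 le.
have [/existsP[p /existsP[q /and3P[pR qC /eqP e]]]|none] :=
  boolP [exists p, exists q,
      [&& row_stab lam p, col_stab lam q & T == fill_act p (fill_act q U)]].
  have /is_ssytP[_ U_col] := Us; have [le' eq1] := row_weight_col lam_n U_col qC.
  have q1 : q = 1%g.
    by apply: eq1; apply/eqP; rewrite eqn_leq le' -(row_weight_row (fill_act q U) pR) -e.
  by move: e Ts; rewrite q1 fill_act1 => -> pUs; apply: is_ssyt_row_eq pUs.
case/eqP: ne0; rewrite big1 // => p pR; rewrite big1 // => q qC.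
have [e|] := eqVneq T; last by rewrite mulr0.
by case/negP: none; apply/existsP; exists p; apply/existsP; exists q; rewrite pR qC e /=.
Qed.

Lemma co_young_vec_diag T : X T -> is_ssyt lam T -> co T (young_vec T) != 0.
Proof.
move=> XT Ts; rewrite co_young_vec // (eq_bigr (fun p => (T == fill_act p T)%:R)).
  rewrite -natr_sum pnatr_eq0 -lt0n (bigD1 1%g) ?row_stab1 //=.
  by rewrite fill_act1 eqxx.
move=> p pR; rewrite (bigD1 1%g) ?col_stab1 //= fill_act1 odd_perm1 mul1r.
rewrite big1 ?addr0 // => q /andP[qC q_neq1].
have [e|] := eqVneq T; last by rewrite mulr0.
have /is_ssytP[_ T_col] := Ts; have [_ eq1] := row_weight_col lam_n T_col qC.
by case/eqP: q_neq1; apply: eq1; rewrite [in RHS]e (row_weight_row _ pR).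
Qed.

Lemma young_vec_free : free [seq young_vec U | U <- enum ssyt_in].
Proof.
pose t := enum_tuple ssyt_in.
have tX i : X (tnth t i) /\ is_ssyt lam (tnth t i).
  by have := mem_tnth i t; rewrite mem_enum => /andP[].
suff : free (map_tuple young_vec t) by [].
apply/freeP => k k0 i; apply/eqP.
have nthE (j : 'I_#|ssyt_in|) : (map_tuple young_vec t)`_j = young_vec (tnth t j).
  by rewrite -tnth_nth tnth_map.
apply/negPn/negP => ki.
have [j kj j_max] :=
  @arg_maxnP _ i (fun j => k j != 0) (fun j => row_weight lam (tnth t j)) ki.
have /eqP := congr1 (co (tnth t j)) k0; rewrite co_sum raddf0 (bigD1 j) //=.
rewrite big1 ?addr0 => [|l nelj].
  by rewrite nthE mulf_eq0 (negPf kj) (negPf (co_young_vec_diag (tX j).1 (tX j).2)).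
rewrite nthE; have [->|kl] := eqVneq (k l) 0; first by rewrite mul0r.
have [->|ne] := eqVneq (co (tnth t j) (young_vec (tnth t l))) 0; first by rewrite mulr0.
have := co_young_vec_neq0 (tX j).1 (tX l).1 (tX j).2 (tX l).2 ne (j_max l kl).
have /tuple_uniqP t_inj : uniq t by apply: enum_uniq.
by move/t_inj => e; rewrite e eqxx in nelj.
Qed.

Hypothesis v_gen : forall x, x = \sum_(T | X T) co T x *: v T.

Lemma dim_limg_young (f : 'End(V)) : (forall T, X T -> f (v T) = young_vec T) ->
  \dim (limg f) = #|ssyt_in|.
Proof.
move=> fE; transitivity (size [seq young_vec U | U <- enum ssyt_in]).
  rewrite -(eqP young_vec_free); congr (\dim _); apply/eqP; rewrite eqEsubv.
  apply/andP; split.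
    apply/subvP => y /memv_imgP[x _ ->]; rewrite [x]v_gen linear_sum.
    by apply: rpred_sum => T XT; rewrite linearZ /= fE //; apply/rpredZ/young_vec_span.
  apply/span_subvP => y /mapP[T]; rewrite mem_enum => /andP[XT _] ->.
  by rewrite -fE // memv_img ?memvf.
by rewrite size_map -cardE.
Qed.

End YoungBasis.

(** * Homomorphisms from the Specht module *)

Section GroupAlgebraAction.
Variables (F : fieldType) (n : nat) (V : vectType F) (rho : 'S_n -> 'End(V)).

Definition galg_op (x : groupalg F n) : 'End(V) := \sum_g x g *: rho g.

Definition galg_app (v : V) (x : groupalg F n) : V := galg_op x v.

Lemma galg_appE v x : galg_app v x = \sum_g x g *: rho g v.
Proof. by rewrite /galg_app sum_lfunE; apply: eq_bigr => g _; rewrite scale_lfunE. Qed.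

Lemma galg_app_is_linear v : linear (galg_app v).
Proof.
move=> a x y; rewrite !galg_appE scaler_sumr -big_split; apply: eq_bigr => g _.
by rewrite !ffunE scalerDl scalerA.
Qed.

HB.instance Definition _ v := GRing.isLinear.Build F (groupalg F n) V _
  (galg_app v) (galg_app_is_linear v).

Lemma galg_op_elt s v : galg_op (galg_elt F s) v = rho s v.
Proof.
rewrite -/(galg_app v _) galg_appE (bigD1 s) //= ffunE eqxx scale1r big1 ?addr0 // => g.
by rewrite ffunE => /negPf ->; rewrite scale0r.
Qed.

Hypothesis rhoM : forall s t v, rho s (rho t v) = rho (perm_comp s t) v.

Lemma galg_op_lmul s x v : galg_op (galg_lmul F s x) v = rho s (galg_op x v).
Proof.
rewrite -!/(galg_app v _) !galg_appE linear_sum (reindex_inj (mulIg s)) /=.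
apply: eq_bigr => g _; rewrite linearZ /= rhoM lfunE /= ffunE.
by rewrite /perm_comp mulgK.
Qed.

End GroupAlgebraAction.

Section GroupAlgebra.
Variables (F : numFieldType) (n : nat).
Implicit Types (x y c : groupalg F n) (s t : 'S_n).
Local Notation lmul := (@galg_lmul F n).

Definition galg_mul x y : groupalg F n := galg_op lmul x y.

Lemma galg_op_mul (V : vectType F) (rho : 'S_n -> 'End(V)) x y v :
  (forall s t v, rho s (rho t v) = rho (perm_comp s t) v) ->
  galg_op rho (galg_mul x y) v = galg_op rho x (galg_op rho y v).
Proof.
move=> rhoM; rewrite -/(galg_app rho v _) -/(galg_app rho (galg_op rho y v) _).
rewrite /galg_mul -/(galg_app lmul y x) (galg_appE lmul) linear_sum [RHS]galg_appE.
by apply: eq_bigr => g _; rewrite linearZ /= -(galg_op_lmul rhoM).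
Qed.

Lemma galg_mulA x y z : galg_mul (galg_mul x y) z = galg_mul x (galg_mul y z).
Proof. by apply: galg_op_mul => s t v; apply: galg_lmul_comp. Qed.

Lemma galg_mul_lmul s x y : galg_mul (lmul s x) y = lmul s (galg_mul x y).
Proof. by apply: galg_op_lmul => *; apply: galg_lmul_comp. Qed.

Lemma galg_lmul1 x : lmul 1%g x = x.
Proof. by apply/ffunP => t; rewrite lfunE ffunE /perm_comp invg1 mulg1. Qed.

Lemma galg_elt_sum x : x = \sum_s x s *: galg_elt F s.
Proof.
apply/ffunP => t; rewrite sum_ffunE (bigD1 t) //= !ffunE eqxx big1 ?addr0 => [|s].
  by rewrite [RHS]mulr1.
by rewrite !ffunE eq_sym => /negPf ->; rewrite [LHS]mulr0.
Qed.

(* Maschke: [u] is the average over the group of a linear section of the right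
   multiplication by [c]. *)
Lemma galg_regular c : exists u, galg_mul (galg_mul c u) c = c.
Proof.
pose Rc := linfun (galg_app lmul c).
have RcE y : Rc y = galg_mul y c by rewrite lfunE.
pose L := (Rc^-1)%VF.
pose u := (n`!%:R^-1 : F) *: \sum_g lmul g (L (galg_elt F g^-1%g)).
have mul_u y : galg_mul y u = (n`!%:R^-1 : F) *: \sum_g lmul g (L (lmul g^-1%g y)).
  rewrite {1}/galg_mul /u linearZ /=; congr (_ *: _).
  rewrite -/(galg_app lmul _ _) galg_appE.
  transitivity (\sum_h \sum_g y h *: lmul g (L (galg_elt F (perm_comp g^-1 h)))).
    apply: eq_bigr => h _; rewrite linear_sum scaler_sumr.
    rewrite [RHS](reindex_inj (mulIg h)); apply: eq_bigr => g _ /=.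
    by rewrite galg_lmul_comp /perm_comp invMg mulKVg.
  rewrite exchange_big; apply: eq_bigr => g _ /=.
  rewrite [in RHS](galg_elt_sum y) !linear_sum; apply: eq_bigr => h _.
  by rewrite !linearZ /= galg_lmul_elt.
exists u; rewrite mul_u -RcE linearZ linear_sum /= (eq_bigr (fun=> c)).
  rewrite sumr_const card_Sn -scaler_nat scalerA mulVf ?scale1r //.
  by rewrite pnatr_eq0 -lt0n fact_gt0.
move=> g _; rewrite RcE galg_mul_lmul -RcE limg_lfunVK.
  by rewrite galg_lmul_comp /perm_comp mulVg galg_lmul1.
have -> : lmul g^-1%g c = Rc (galg_elt F g^-1%g).
  by rewrite RcE /galg_mul galg_op_elt.
exact/memv_img/memvf.
Qed.

End GroupAlgebra.

Section Evaluation.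
Variables (F : fieldType) (U V : vectType F) (u : U).

Definition lfun_eval (f : 'Hom(U, V)) : V := f u.

Lemma lfun_eval_is_linear : linear lfun_eval.
Proof. by move=> a f g; rewrite /lfun_eval add_lfunE scale_lfunE. Qed.

HB.instance Definition _ := GRing.isLinear.Build F 'Hom(U, V) V _
  lfun_eval lfun_eval_is_linear.

End Evaluation.

Section HomFromIdeal.
Variables (F : numFieldType) (n : nat) (lam : seq nat).
Variables (V : vectType F) (rho : 'S_n -> 'End(V)).
Hypothesis rhoM : forall s t v, rho s (rho t v) = rho (perm_comp s t) v.
Local Notation c := (young_symmetrizer F n lam).

Lemma young_symmetrizer_specht : c \in specht F n lam.
Proof.
rewrite -[c]galg_lmul1; apply/memv_span/map_f; exact: mem_enum.
Qed.

Lemma specht_act_op x w :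
  vsval (galg_op (@specht_act F n lam) x w) = galg_op (@galg_lmul F n) x (vsval w).
Proof.
rewrite -/(galg_app _ w x) -/(galg_app _ (vsval w) x) !galg_appE linear_sum.
by apply: eq_bigr => g _; rewrite linearZ /= specht_actE.
Qed.

Lemma equiHom_op f x w : f \in equiHom (@specht_act F n lam) rho ->
  f (galg_op (@specht_act F n lam) x w) = galg_op rho x (f w).
Proof.
move=> /equiHomP fP.
rewrite -/(galg_app _ w x) -/(galg_app _ (f w) x) !galg_appE linear_sum.
by apply: eq_bigr => g _; rewrite linearZ /= fP.
Qed.

Lemma dim_equiHom_specht :
  \dim (equiHom (@specht_act F n lam) rho) = \dim (limg (galg_op rho c)).
Proof.
have [u cuc] := galg_regular c.
pose c0 := vsproj (specht F n lam) c.
have c0E : vsval c0 = c by rewrite vsprojK // young_symmetrizer_specht.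
pose ev := linfun (@lfun_eval _ _ V c0).
have evE f : ev f = f c0 by rewrite lfunE.
rewrite -(@limg_dim_eq _ _ _ ev); last first.
  apply/eqP; rewrite -subv0; apply/subvP => f; rewrite memv_cap memv_ker evE memv0.
  move=> /andP[/equiHomP fP /eqP fc0]; apply/eqP/lfunP => w; rewrite zero_lfunE.
  suff sub : (specht F n lam <= linfun vsval @: lker f)%VS.
    have /memv_imgP[w' w'K] := subvP sub _ (subvsP w).
    by rewrite lfunE /= => /subvs_inj ->; apply/eqP; rewrite -memv_ker.
  apply/span_subvP => _ /mapP[s _ ->].
  rewrite -c0E -specht_actE -[vsval _](lfunE vsval); apply: memv_img.
  by rewrite memv_ker fP fc0 linear0.
congr (\dim _); apply/eqP; rewrite eqEsubv; apply/andP; split; apply/subvP => v.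
  move=> /memv_imgP[f fP ->]; rewrite evE.
  have -> : c0 = galg_op (@specht_act F n lam) (galg_mul c u) c0.
    by apply: subvs_inj; rewrite specht_act_op c0E -[galg_op _ _ _]/(galg_mul _ _) cuc.
  by rewrite equiHom_op // galg_op_mul //; apply/memv_img/memvf.
move=> /memv_imgP[m _ ->]; pose y := galg_op rho u (galg_op rho c m).
pose f := (linfun (galg_app rho y) \o linfun vsval)%VF : 'Hom(subvs_of (specht F n lam), V).
have fE w : f w = galg_op rho (vsval w) y.
  by rewrite comp_lfunE lfunE [linfun vsval w]lfunE.
have -> : galg_op rho c m = ev f by rewrite evE fE c0E /y -!galg_op_mul // cuc.
by apply/memv_img/equiHomP => s w; rewrite !fE specht_actE galg_op_lmul.
Qed.

End HomFromIdeal.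

(** * Traces and the power-sum expansion *)

Lemma trace_idempotent (F : fieldType) (V : vectType F) (I : finType) (P : pred I)
    (v : I -> V) (co : I -> {scalar V}) (f : 'End(V)) :
  (forall x, x = \sum_(i | P i) co i x *: v i) -> (forall x, f (f x) = f x) ->
  \sum_(i | P i) co i (f (v i)) = (\dim (limg f))%:R.
Proof.
move=> v_gen ff; pose b := vbasis (limg f).
have fb x : f x = \sum_j coord b j (f x) *: b`_j.
  by apply: coord_vbasis; apply/memv_img/memvf.
have bK (j : 'I_(\dim (limg f))) : f b`_j = b`_j.
  have /memv_imgP[x _ ->] : b`_j \in limg f by apply/vbasis_mem/mem_nth; rewrite size_tuple.
  exact: ff.
transitivity (\sum_(i | P i) \sum_j coord b j (f (v i)) * co i b`_j).
  apply: eq_bigr => i _; rewrite [in LHS]fb raddf_sum; apply: eq_bigr => j _.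
  exact: scalarZ.
rewrite exchange_big /= -[X in X%:R]card_ord -sumr_const; apply: eq_bigr => j _.
transitivity (coord b j (f (\sum_(i | P i) co i b`_j *: v i))).
  rewrite !linear_sum; apply: eq_bigr => i _.
  by rewrite !linearZ /= mulrC.
by rewrite -v_gen bK (coord_free _ _ (basis_free (vbasisP _))) eqxx.
Qed.

Section YoungSymmetrizerImage.
Variables (F : numFieldType) (V : vectType F) (n N : nat) (lam : seq nat).
Hypothesis lam_n : is_intpart n lam.
Variables (rho : 'S_n -> 'End(V)).
Hypothesis rhoM : forall s t v, rho s (rho t v) = rho (perm_comp s t) v.
Variables (v : {ffun 'I_n -> 'I_N} -> V) (X : pred {ffun 'I_n -> 'I_N}).
Hypothesis X_stable : forall s T, X T -> X (fill_act s T).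
Hypothesis rho_v : forall s T, X T -> rho s (v T) = v (fill_act s T).
Variable co : {ffun 'I_n -> 'I_N} -> {scalar V}.
Hypothesis co_v : forall T U, X T -> X U -> co T (v U) = (T == U)%:R.
Hypothesis v_gen : forall x, x = \sum_(T | X T) co T x *: v T.
Local Notation c := (young_symmetrizer F n lam).

Lemma dim_young_symmetrizer_image :
  \dim (limg (galg_op rho c)) = #|ssyt_in lam X|.
Proof.
apply: (dim_limg_young lam_n X_stable co_v v_gen) => T XT.
rewrite -/(galg_app rho (v T) c) linear_sum; apply: eq_bigr => p _.
rewrite linear_sum; apply: eq_bigr => q _; rewrite linearZ /=; congr (_ *: _).
by rewrite [LHS]galg_op_elt rho_v // fill_actM.
Qed.

Lemma fixed_fillings_ssyt u : galg_mul (galg_mul c u) c = c ->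
  \sum_s galg_mul c u s * #|[pred T | X T & fill_act s T == T]|%:R
    = #|ssyt_in lam X|%:R :> F.
Proof.
move=> cuc; rewrite -dim_young_symmetrizer_image.
have -> : limg (galg_op rho c) = limg (galg_op rho (galg_mul c u)).
  apply/eqP; rewrite eqEsubv; apply/andP; split; apply/subvP => y /memv_imgP[x _ ->].
    by rewrite -{1}cuc galg_op_mul //; apply/memv_img/memvf.
  by rewrite galg_op_mul //; apply/memv_img/memvf.
rewrite -(trace_idempotent v_gen); last first.
  by move=> x; rewrite -galg_op_mul // -galg_mulA cuc.
rewrite (eq_bigr (fun T => \sum_s galg_mul c u s * (fill_act s T == T)%:R)).
  rewrite exchange_big; apply: eq_bigr => s _ /=; rewrite -mulr_sumr; congr (_ * _).
  by rewrite -sum1_card natr_sum big_mkcondr; apply: eq_bigr => T _; case: eqP.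
move=> T XT; rewrite -/(galg_app rho (v T) _) galg_appE raddf_sum; apply: eq_bigr => s _.
by rewrite [LHS]scalarZ rho_v // co_v ?X_stable // eq_sym.
Qed.

End YoungSymmetrizerImage.

Section PermutationModule.
Variables (F : numFieldType) (n N : nat) (X : pred {ffun 'I_n -> 'I_N}).
Hypothesis X_stable : forall s T, X T -> X (fill_act s T).
Implicit Types (s t : 'S_n) (T : {ffun 'I_n -> 'I_N}).

Local Notation Xsub := {T : {ffun 'I_n -> 'I_N} | X T}.
Definition fill_module := {ffun Xsub -> F^o}.
HB.instance Definition _ := Vector.on fill_module.

Definition sub_act s (i : Xsub) : Xsub := Sub (fill_act s (val i)) (X_stable s (valP i)).

Definition fill_module_act_fun s (f : fill_module) : fill_module :=
  [ffun i => f (sub_act s^-1%g i)].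

Lemma fill_module_act_is_linear s : linear (fill_module_act_fun s).
Proof. by move=> a f g; apply/ffunP => i; rewrite !ffunE. Qed.

HB.instance Definition _ s := GRing.isLinear.Build F fill_module fill_module _
  (fill_module_act_fun s) (fill_module_act_is_linear s).

Definition fill_module_act s : 'End(fill_module) := linfun (fill_module_act_fun s).

Definition fill_delta T : fill_module := [ffun i => (val i == T)%:R].

Definition fill_coef T (f : fill_module) : F := \sum_(i : Xsub | val i == T) f i.

Lemma fill_coef_is_linear T : scalar (fill_coef T).
Proof.
move=> a f g; rewrite /fill_coef mulr_sumr -big_split; apply: eq_bigr => i _.
by rewrite !ffunE.
Qed.

HB.instance Definition _ T := GRing.isLinear.Build F fill_module F _
  (fill_coef T) (fill_coef_is_linear T).

Lemma fill_module_actM s t f :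
  fill_module_act s (fill_module_act t f) = fill_module_act (perm_comp s t) f.
Proof.
rewrite !lfunE; apply/ffunP => i; rewrite !ffunE; congr (f _); apply: val_inj.
by rewrite /= -fill_actM /perm_comp invMg.
Qed.

Lemma fill_module_act_delta s T :
  fill_module_act s (fill_delta T) = fill_delta (fill_act s T).
Proof.
rewrite lfunE; apply/ffunP => i; rewrite !ffunE /=.
by rewrite -(inj_eq (@fill_act_inj _ _ s)) -fill_actM mulVg fill_act1.
Qed.

Lemma fill_coef_delta T U : X T -> fill_coef T (fill_delta U) = (T == U)%:R.
Proof.
move=> XT; rewrite /fill_coef (big_pred1 (exist _ T XT)) ?ffunE //.
Qed.

Lemma fill_module_gen (f : fill_module) :
  f = \sum_(T | X T) fill_coef T f *: fill_delta T.
Proof.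
apply/ffunP => i; rewrite sum_ffunE (bigD1 (val i)) ?(valP i) //= !ffunE eqxx.
rewrite big1 ?addr0 => [|T /andP[_ neT]].
  by rewrite [RHS]mulr1 /fill_coef (big_pred1 i).
by rewrite !ffunE eq_sym (negPf neT) [LHS]mulr0.
Qed.

End PermutationModule.

(* [galg_mul c u] is an idempotent generating the Specht module; the left-hand
   side is its trace on the permutation module spanned by [X]. *)
Lemma exists_ssyt_trace (F : numFieldType) n lam : is_intpart n lam ->
  exists e : 'S_n -> F, forall N (X : pred {ffun 'I_n -> 'I_N}),
    (forall s T, X T -> X (fill_act s T)) ->
    \sum_s e s * #|[pred T | X T & fill_act s T == T]|%:R = #|ssyt_in lam X|%:R.
Proof.
move=> lam_n; have [u cuc] := galg_regular (young_symmetrizer F n lam).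
exists (galg_mul (young_symmetrizer F n lam) u) => N X X_stable.
apply: (fixed_fillings_ssyt lam_n (rho := fill_module_act F X_stable)
  (v := fill_delta F X) (co := fun T => fill_coef (F := F) (X := X) T) _ _ _ _ _ cuc) => //.
- exact: fill_module_actM.
- by move=> s T _; apply: fill_module_act_delta.
- by move=> T U XT _; apply: fill_coef_delta.
- exact: fill_module_gen.
Qed.

Section CyclePolynomial.
Variables (n N : nat) (s : 'S_n).

Local Notation cycles := {D : {set 'I_n} | D \in porbits s}.

Definition cycle_of (a : 'I_n) : cycles :=
  exist _ (porbit s a) (imset_f (porbit s) (isT : a \in 'I_n)).

Lemma cycle_of_surj (D : cycles) : exists a, cycle_of a == D.
Proof. by have /imsetP[a _ e] := valP D; exists a; apply/eqP/val_inj. Qed.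

Definition cycle_filling (f : {ffun cycles -> 'I_N}) : {ffun 'I_n -> 'I_N} :=
  [ffun a => f (cycle_of a)].

Lemma cycle_filling_inj : injective cycle_filling.
Proof.
move=> f g /ffunP e; apply/ffunP => D; have [a /eqP <-] := cycle_of_surj D.
by have := e a; rewrite !ffunE.
Qed.

Lemma fixed_cycle_filling : 
  [set T | fill_act s T == T] = [set cycle_filling f | f in predT].
Proof.
apply/setP => T; rewrite inE; apply/eqP/imsetP => [sT|[f _ ->]].
  have T_orb a b : cycle_of a = cycle_of b -> T a = T b.
    move/(congr1 val)/eqP; rewrite /= eq_porbit_mem => /porbitP[i ->] {a}.
    elim: i => [|i IH]; first by rewrite expg0 perm1.
    by rewrite expgSr permM -{1}sT ffunE permK.
  pose g D := xchoose (cycle_of_surj D).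
  exists [ffun D => T (g D)] => //; apply/ffunP => a; rewrite !ffunE.
  by apply: T_orb; rewrite (eqP (xchooseP (cycle_of_surj (cycle_of a)))).
apply/ffunP => a; rewrite !ffunE; congr (f _); apply: val_inj => /=.
by rewrite -[in RHS](permKV s a) -[s _]/((s ^+ 1)%g _) porbit_perm.
Qed.

Definition cycle_poly : {mpoly rat[n]} :=
  \prod_(D : cycles) \sum_(i < n | i.+1 == #|val D|) 'X_i.

Lemma cycle_poly_psum :
  cycle_poly \mPo [tuple power_sum N i.+1 | i < n] =
  \sum_(T : {ffun 'I_n -> 'I_N} | fill_act s T == T) \prod_a 'X_(T a).
Proof.
transitivity (\prod_(D : cycles) power_sum N #|val D|).
  rewrite /cycle_poly rmorph_prod; apply: eq_bigr => D _; rewrite raddf_sum /=.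
  have [a aD] : exists a, a \in val D.
    by have [a /eqP <-] := cycle_of_surj D; exists a; apply: porbit_id.
  have D_gt0 : (0 < #|val D|)%N by apply/card_gt0P; exists a.
  have lt_n : (#|val D|.-1 < n)%N by rewrite prednK // -[n in (_ <= n)%N]card_ord max_card.
  rewrite (big_pred1 (Ordinal lt_n)) => [|i].
    by rewrite comp_mpolyXU -tnth_nth tnth_mktuple /= prednK.
  by apply/eqP/eqP => [e|->]; [apply: val_inj; rewrite /= -e | rewrite /= prednK].
rewrite /power_sum bigA_distr_bigA /=.
rewrite [RHS](eq_bigl (mem [set T | fill_act s T == T])) => [|T]; last by rewrite !inE.
rewrite fixed_cycle_filling big_imset /=; last exact: in2W cycle_filling_inj.
apply: eq_bigr => f _.
rewrite [RHS](partition_big cycle_of predT) //=; apply: eq_bigr => D _.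
rewrite (eq_bigr (fun=> 'X_(f D))) => [|a /eqP <-]; last by rewrite ffunE.
rewrite prodr_const; congr (_ ^+ _).
have [b /eqP <-] := cycle_of_surj D; apply: eq_card => a.
by rewrite [RHS]unfold_in /= -eq_porbit_mem.
Qed.

End CyclePolynomial.

Section Weight.
Variables (n N : nat).
Implicit Types T : {ffun 'I_n -> 'I_N}.

Definition fill_mon T : 'X_{1..N} := (\sum_a U_(T a))%MM.

Lemma prod_fill_mon (R : nzRingType) T : \prod_a 'X_(T a) = 'X_[fill_mon T] :> {mpoly R[N]}.
Proof. exact: mprodXE. Qed.

Lemma fill_mon_act s T : fill_mon (fill_act s T) = fill_mon T.
Proof.
rewrite /fill_mon (reindex_inj (@perm_inj _ s)) /=.
by apply: eq_bigr => a _; rewrite ffunE permK.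
Qed.

End Weight.

Lemma exists_psum_expansion n lam : is_intpart n lam ->
  exists f : {mpoly rat[n]}, psum_expansion lam f.
Proof.
move=> lam_n; have [e eP] := exists_ssyt_trace rat lam_n.
exists (\sum_s e s *: cycle_poly s) => N.
transitivity (\sum_s e s *:
    \sum_(T : {ffun 'I_n -> 'I_N} | fill_act s T == T) 'X_[fill_mon T] : {mpoly rat[N]}).
  rewrite raddf_sum; apply: eq_bigr => s _; rewrite /= comp_mpolyZ cycle_poly_psum.
  by congr (_ *: _); apply: eq_bigr => T _; apply: prod_fill_mon.
apply/mpolyP => m; rewrite /schur !raddf_sum /=.
have := eP N [pred T | fill_mon T == m]; rewrite /= => eq_m.
transitivity (#|ssyt_in lam [pred T : {ffun 'I_n -> 'I_N} | fill_mon T == m]|%:R : rat).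
  rewrite -eq_m => [|s T]; last by rewrite fill_mon_act.
  apply: eq_bigr => s _; rewrite mcoeffZ raddf_sum /=; congr (_ * _).
  rewrite -sum1_card natr_sum [RHS]big_mkcondl [LHS]big_mkcond.
  rewrite [RHS]big_mkcond; apply: eq_bigr => T _ /=.
  by rewrite mcoeffX; case: ifP => //; case: ifP.
rewrite -sum1_card natr_sum big_mkcondl; apply: eq_bigr => T _ /=.
by rewrite prod_fill_mon mcoeffX; case: eqP.
Qed.

(** * The plethysm *)

Section PowerSeries.
Variable R : comNzRingType.
Implicit Types f g : fps R.

Lemma fps_coef_sum (I : Type) (s : seq I) (P : pred I) (h : I -> fps R) i :
  fps_coef (\sum_(j <- s | P j) h j) i = \sum_(j <- s | P j) fps_coef (h j) i.
Proof. by apply: (big_morph (fun f => fps_coef f i)) => [f g|] //=; rewrite if_same. Qed.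

Lemma fps_coefM f g i :
  fps_coef (f * g) i = \sum_(j < i.+1) fps_coef f j * fps_coef g (i - j)%N.
Proof. by []. Qed.

Lemma fpsC_is_zmod_morphism : zmod_morphism (@fpsC R).
Proof. by move=> a b; apply: fpsP => i /=; case: eqP; rewrite ?subr0. Qed.

Lemma fpsC_is_monoid_morphism : monoid_morphism (@fpsC R).
Proof.
split=> // a b; apply: fpsP => -[|i]; rewrite fps_coefM.
  by rewrite big_ord1.
by rewrite big1 // => -[[|j] ltj] _ /=; rewrite ?mulr0 ?mul0r.
Qed.

HB.instance Definition _ := GRing.isZmodMorphism.Build R (fps R)
  (@fpsC R) fpsC_is_zmod_morphism.
HB.instance Definition _ := GRing.isMonoidMorphism.Build R (fps R)
  (@fpsC R) fpsC_is_monoid_morphism.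

Lemma fps_coef_qXM m f i :
  fps_coef (fps_qX R m * f) i = if (m <= i)%N then fps_coef f (i - m)%N else 0.
Proof.
rewrite fps_coefM; case: leqP => [le|lt].
  have ltm : (m < i.+1)%N by [].
  rewrite (bigD1 (Ordinal ltm)) //= eqxx mul1r big1 ?addr0 // => j.
  by rewrite -(inj_eq val_inj) /= => /negPf ->; rewrite mul0r.
rewrite big1 // => j _ /=; case: eqP => [e|]; rewrite ?mul0r //.
by have := ltn_ord j; rewrite e ltnS leqNgt lt.
Qed.

Lemma fps_qX0 : fps_qX R 0 = 1.
Proof. by apply: fpsP => -[|i]. Qed.

Lemma fps_qXD m l : fps_qX R (m + l) = fps_qX R m * fps_qX R l.
Proof.
apply: fpsP => i; rewrite fps_coef_qXM /=; case: leqP => [le|lt].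
  by congr (_%:R); congr nat_of_bool; lia.
by case: eqP => // e; exfalso; lia.
Qed.

Lemma fps_qX_sum (I : finType) (d : I -> nat) :
  fps_qX R (\sum_i d i) = \prod_i fps_qX R (d i).
Proof. exact: (big_morph _ fps_qXD fps_qX0). Qed.

Lemma fps_qXMn m l : fps_qX R (m * l) = fps_qX R m ^+ l.
Proof.
elim: l => [|l IH]; first by rewrite muln0 fps_qX0 expr0.
by rewrite mulnS fps_qXD IH exprS.
Qed.

Lemma fps_geom_exp_coef m k i : (0 < m)%N ->
  fps_coef (fps_geom R m ^+ k) i =
    if (m %| i)%N then 'C((k + i %/ m).-1, i %/ m)%N%:R else 0.
Proof.
move=> m_gt0; elim: k i => [|k IHk] i.
  rewrite expr0 /=; case: i => [|i] /=; first by rewrite dvdn0 div0n bin0.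
  case: ifP => // /divnK; case: (_ %/ m)%N => [|q _]; first by rewrite mul0n.
  by rewrite bin_small // add0n.
have [d] := ubnP i; elim: d i => // d IHd i; rewrite ltnS => led.
have geomE : fps_geom R m = 1 + fps_qX R m * fps_geom R m.
  by apply/eqP; rewrite -subr_eq -{1}[fps_geom R m]mul1r -mulrBl fps_geomP.
have -> : fps_coef (fps_geom R m ^+ k.+1) i =
    fps_coef (fps_geom R m ^+ k) i +
    fps_coef (fps_qX R m * fps_geom R m ^+ k.+1) i.
  rewrite -[RHS]/(fps_coef (_ + _) i); congr (fps_coef _ i).
  by rewrite exprS {1}geomE mulrDl mul1r mulrA.
rewrite IHk fps_coef_qXM; case: leqP => [le|lt].
  rewrite IHd; last by lia.
  rewrite dvdn_subl ?dvdnn //.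
  have [/dvdnP[q e]|_] := boolP (m %| i)%N; last by rewrite addr0.
  have q_gt0 : (0 < q)%N by move: le; rewrite e; case: (q) => //; rewrite mul0n; lia.
  have -> : (i - m)%N = (q.-1 * m)%N by rewrite e -{1}(prednK q_gt0) mulSn addKn.
  rewrite e !mulnK // -natrD; congr (_%:R); case: q q_gt0 {e} => // q _ /=.
  by rewrite !addnS /= binS.
rewrite addr0; have [/dvdnP[[|q] e]|//] := boolP (m %| i)%N.
  by rewrite e mul0n div0n !bin0.
by move: lt; rewrite e mulSn; lia.
Qed.

Definition fps_eq_upto r f g := forall i, (i <= r)%N -> fps_coef f i = fps_coef g i.

Lemma fps_eq_uptoM r f1 f2 g1 g2 :
  fps_eq_upto r f1 g1 -> fps_eq_upto r f2 g2 -> fps_eq_upto r (f1 * f2) (g1 * g2).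
Proof.
move=> h1 h2 i le; rewrite !fps_coefM; apply: eq_bigr => j _.
have := ltn_ord j; rewrite ltnS => lej.
by rewrite h1 ?h2 //; [apply: leq_trans le; apply: leq_subr | apply: leq_trans le].
Qed.

Lemma fps_eq_upto_mmap r n (p : {mpoly R[n]}) (h1 h2 : 'I_n -> fps R) :
  (forall i, fps_eq_upto r (h1 i) (h2 i)) ->
  fps_eq_upto r (mmap (@fpsC R) h1 p) (mmap (@fpsC R) h2 p).
Proof.
move=> h i le; rewrite /mmap !fps_coef_sum; apply: eq_bigr => m _.
apply: (@fps_eq_uptoM r) => // {i le}.
rewrite /mmap1; elim/big_ind2: _ => // [*|j _]; first exact: fps_eq_uptoM.
by elim: (m j) => [|l IH]; rewrite ?expr0 ?exprS //; apply: fps_eq_uptoM.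
Qed.

End PowerSeries.

Lemma mmap_comp_mpoly (R : comNzRingType) (S : comNzRingType) (f : {rmorphism R -> S})
    n N (h : 'I_N -> S) (p : {mpoly R[n]}) (lq : n.-tuple {mpoly R[N]}) :
  mmap f h (p \mPo lq) = mmap f (fun i => mmap f h (tnth lq i)) p.
Proof.
rewrite comp_mpolyEX raddf_sum /=; apply: eq_bigr => m _.
rewrite mmapZ comp_mpolyX rmorph_prod; congr (_ * _).
by apply: eq_bigr => i _; rewrite rmorphXn.
Qed.

Lemma schur_psumP n lam : is_intpart n lam -> psum_expansion lam (schur_psum n lam).
Proof.
move=> /exists_psum_expansion.
exact: (@classical_sets.xgetPex _ 0 (@psum_expansion n lam)).
Qed.

(* Up to degree [r], the substitution p_m -> (1 - q^m)^-k is induced by the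
   specialization of the i-th variable to [q ^ dg i]. *)
Lemma schur_plethysm_coef n k lam N (dg : 'I_N -> nat) r : is_intpart n lam ->
  (forall d, (d <= r)%N -> #|[pred i | dg i == d]| = 'C((k + d).-1, d)) ->
  fps_coef (schur_plethysm n k lam) r =
    #|ssyt_in lam [pred T : {ffun 'I_n -> 'I_N} | (\sum_a dg (T a) == r)%N]|%:R.
Proof.
move=> lam_n dg_card.
pose ev := mmap (@fpsC rat) (fun i : 'I_N => fps_qX rat (dg i)).
have ev_psum m : ev (power_sum N m) = \sum_i fps_qX rat (dg i * m).
  rewrite /ev raddf_sum; apply: eq_bigr => i _.
  by rewrite fps_qXMn /= rmorphXn /= mmapX mmap1U.
transitivity (fps_coef (ev (schur n lam N)) r).
  rewrite -(schur_psumP lam_n) /ev mmap_comp_mpoly.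
  apply: fps_eq_upto_mmap (leqnn r) => i j le.
  rewrite tnth_mktuple -/ev ev_psum fps_geom_exp_coef // fps_coef_sum /=.
  have [/dvdnP[q e]|ndvd] := boolP (i.+1 %| j)%N.
    rewrite e mulnK // -dg_card; last by move: le; rewrite e mulnS; lia.
    rewrite -sum1_card natr_sum big_mkcond; apply: eq_bigr => l _.
    by rewrite eqn_pmul2r // eq_sym inE; case: eqP.
  rewrite big1 // => l _; case: eqP => // e; case/negP: ndvd.
  by rewrite e dvdn_mull.
rewrite /schur /ev raddf_sum fps_coef_sum -sum1_card natr_sum.
rewrite [RHS]big_mkcondl; apply: eq_bigr => T _ /=.
rewrite rmorph_prod (eq_bigr (fun a => fps_qX rat (dg (T a)))); last first.
  by move=> a _; rewrite /= mmapX mmap1U.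
by rewrite -fps_qX_sum /= eq_sym; case: eqP.
Qed.

(** * Letters and the minimal degree *)

Section Letters.
Variable k : nat.

Definition degree_monomials d : seq 'X_{1..k} :=
  [seq s2m t | t : d.-tuple 'I_k <- enum (basis k d)].

Fixpoint letters D : seq 'X_{1..k} :=
  if D is D'.+1 then letters D' ++ degree_monomials D' else [::].

Lemma mem_letters D m : (m \in letters D) = (mdeg m < D)%N.
Proof.
elim: D => [|D IH] //=; rewrite mem_cat IH -basis_cover ltnS.
by case: ltngtP.
Qed.

Lemma letters_uniq D : uniq (letters D).
Proof.
elim: D => //= D IH; rewrite cat_uniq IH uniq_basis andbT /=.
by apply/hasPn => m; rewrite -basis_cover mem_letters => /eqP ->; rewrite ltnn.
Qed.

Hypothesis k_gt0 : (0 < k)%N.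

Lemma size_degree_monomials d : size (degree_monomials d) = 'C((k + d).-1, d).
Proof.
rewrite /degree_monomials; case: k k_gt0 => // k' _.
by rewrite size_basis addSn addnC.
Qed.

Lemma tsumS d : tsum k d.+1 = (tsum k d + 'C((k + d).-1, d))%N.
Proof. by rewrite /tsum big_nat_recr. Qed.

Lemma tsum_ltS d : (tsum k d < tsum k d.+1)%N.
Proof.
by rewrite tsumS -[ltnLHS]addn0 ltn_add2l bin_gt0 -(prednK k_gt0) addSn leq_addl.
Qed.

Lemma tsum_le d e : (d <= e)%N -> (tsum k d <= tsum k e)%N.
Proof.
by apply: (homo_leq leqnn (fun y x z => @leq_trans y x z)) => i; apply/ltnW/tsum_ltS.
Qed.

Lemma leq_tsum d : (d <= tsum k d)%N.
Proof. by elim: d => // d IH; apply: leq_ltn_trans IH (tsum_ltS d). Qed.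

Lemma size_letters D : size (letters D) = tsum k D.
Proof.
elim: D => [|D IH] /=; first by rewrite /tsum big_geq.
by rewrite size_cat IH size_degree_monomials tsumS.
Qed.

Lemma count_letters D d : (d < D)%N ->
  count (fun m => mdeg m == d) (letters D) = 'C((k + d).-1, d).
Proof.
elim: D => //= D IH; rewrite ltnS count_cat leq_eqVlt => /predU1P[->|lt].
  rewrite (eq_in_count (a2 := pred0)) ?count_pred0 ?add0n => [|m]; last first.
    by rewrite mem_letters => /ltn_eqF.
  rewrite (eq_in_count (a2 := predT)) ?count_predT ?size_degree_monomials // => m.
  by rewrite -basis_cover.
rewrite IH // (eq_in_count (a2 := pred0)) ?count_pred0 ?addn0 // => m.
by rewrite -basis_cover => /eqP ->; apply: gtn_eqF.
Qed.

Definition letter_deg i := mdeg (nth 0%MM (letters i.+1) i).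

Lemma mdeg_letter_bounds D i : (i < tsum k D)%N ->
  (tsum k (mdeg (nth 0%MM (letters D) i)) <= i
     < tsum k (mdeg (nth 0%MM (letters D) i)).+1)%N.
Proof.
elim: D => [|D IH]; first by rewrite /tsum big_geq.
rewrite /= nth_cat size_letters; case: (ltnP i (tsum k D)) => [/IH //|le lt].
set m := nth _ _ _; have : m \in degree_monomials D.
  by apply: mem_nth; rewrite size_degree_monomials ltn_subLR // -tsumS.
by rewrite -basis_cover => /eqP ->; rewrite le lt.
Qed.

Lemma letter_deg_bounds i : (tsum k (letter_deg i) <= i < tsum k (letter_deg i).+1)%N.
Proof. exact/mdeg_letter_bounds/leq_tsum. Qed.

Lemma letter_deg_eq i d : (tsum k d <= i < tsum k d.+1)%N -> letter_deg i = d.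
Proof.
have /andP[h1 h2] := letter_deg_bounds i; case/andP => h3 h4.
case: (ltngtP (letter_deg i) d) => // /tsum_le le.
  by have := leq_ltn_trans (leq_trans le h3) h2; rewrite ltnn.
by have := leq_ltn_trans (leq_trans le h1) h4; rewrite ltnn.
Qed.

Lemma mdeg_letter D i : (i < tsum k D)%N -> mdeg (nth 0%MM (letters D) i) = letter_deg i.
Proof. by move/mdeg_letter_bounds/letter_deg_eq. Qed.

Lemma letter_deg_le i j : (i <= j)%N -> (letter_deg i <= letter_deg j)%N.
Proof.
move=> le; have /andP[h1 _] := letter_deg_bounds i; have /andP[_ h2] := letter_deg_bounds j.
rewrite leqNgt; apply/negP => /tsum_le h.
by have := leq_ltn_trans (leq_trans h (leq_trans h1 le)) h2; rewrite ltnn.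
Qed.

Lemma deg_sumE lam J :
  deg_sum k lam J = (\sum_(0 <= i < tsum k J) nth 0 lam i * letter_deg i)%N.
Proof.
rewrite /deg_sum big_add1 /=; elim: J => [|J IH].
  by rewrite /tsum !big_geq.
rewrite big_nat_recr //= IH [RHS](@big_cat_nat _ _ _ (tsum k J)) ?tsum_le //=.
congr (_ + _)%N; rewrite big_add1 /= big_distrr /=.
by apply: eq_big_nat => i /letter_deg_eq ->; rewrite mulnC.
Qed.

Lemma deg_boundE lam :
  deg_bound k lam = (\sum_(i < size lam) nth 0 lam i * letter_deg i)%N.
Proof.
rewrite /deg_bound deg_sumE (@big_cat_nat _ _ _ (size lam)) ?leq_tsum //=.
rewrite [X in (_ + X)%N]big_nat [X in (_ + X)%N]big1 ?addn0 ?big_mkord // => i /andP[le _].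
by rewrite nth_default.
Qed.

End Letters.

Section MinimalDegree.
Variables (n k r : nat) (lam : seq nat).
Hypothesis lam_n : is_intpart n lam.
Hypothesis k_gt0 : (0 < k)%N.
Hypothesis n_gt0 : (0 < n)%N.
Local Notation row := (row_of lam).
Local Notation col := (col_of lam).
Local Notation N := (tsum k r.+1).

Lemma sum_row_of (f : nat -> nat) :
  (\sum_(a < n) f (row a) = \sum_(i < size lam) nth 0 lam i * f i)%N.
Proof.
pose rowo (a : 'I_n) := Ordinal (row_of_lt_size lam_n a).
rewrite (partition_big rowo predT) //=; apply: eq_bigr => i _.
rewrite (eq_bigr (fun=> f i)) => [|a /eqP <- //].
rewrite sum_nat_const; congr (_ * _)%N.
have ltn (j : 'I_(nth 0%N lam i)) : (flatten_index lam i j < n)%N.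
  by rewrite -(sumn_intpart lam_n); apply: flatten_indexP.
rewrite -[RHS]card_ord -(card_imset _ (f := fun j => Ordinal (ltn j))); last first.
  move=> j j' /(congr1 (fun a : 'I_n => col a)).
  by rewrite /col_of /= !flatten_indexKr // => /val_inj.
apply: eq_card => a; rewrite [LHS]unfold_in; apply/eqnP/imsetP => [/= e|[j _ ->]].
  have lt : (col a < nth 0%N lam i)%N by rewrite -e col_of_lt_nth.
  exists (Ordinal lt) => //; apply: val_inj; rewrite /= -[LHS](reshape_indexK lam).
  by rewrite -/(row a) e.
by rewrite /= /row_of /= flatten_indexKl.
Qed.

Lemma row_of_le_ssyt M (T : {ffun 'I_n -> 'I_M}) (a : 'I_n) :
  is_ssyt lam T -> (row a <= T a)%N.
Proof.
case/is_ssytP => _ T_col; move: {2}(row a) (erefl (row a)) => i; elim: i a => [|i IH] a e.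
  by rewrite e.
have [||b [er ec]] := @diagram_down_closed _ _ lam_n a i (col a); rewrite ?e //.
by apply: leq_ltn_trans (T_col b a _ _); rewrite ?ec ?er ?e // -[X in (X <= _)%N]er IH.
Qed.

Lemma exists_ssyt_degree :
  (0 < #|ssyt_in lam [pred T : {ffun 'I_n -> 'I_N} | (\sum_a letter_deg k (T a) == r)%N]|)%N
  <-> (deg_bound k lam <= r)%N.
Proof.
rewrite deg_boundE // -sum_row_of; split.
  case/card_gt0P => T /andP[/eqP sT T_ssyt]; apply: leq_trans (eq_leq sT).
  apply: leq_sum => a _.
  exact/letter_deg_le/row_of_le_ssyt.
set B := (\sum_(a < n) _)%N => leB.
have lam_gt0 : (0 < size lam)%N.
  by rewrite lt0n size_eq0; apply: contraTneq n_gt0 => e; rewrite -(sumn_intpart lam_n) e.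
pose l := (size lam).-1.
have nth_gt0 : (0 < nth 0 lam l)%N.
  rewrite lt0n; apply: contraTneq (mem_nth 0%N (_ : l < size lam)%N) => [->|].
    by case/and3P: lam_n.
  by rewrite prednK.
have [z [rz cz]] : exists z : 'I_n, row z = l /\ col z = (nth 0 lam l).-1.
  by apply: (exists_cell lam_n); rewrite prednK.
pose d := (letter_deg k l + (r - B))%N.
pose x := maxn l (tsum k d).
have x_deg : letter_deg k x = d.
  have /andP[h1 h2] := letter_deg_bounds k_gt0 l.
  rewrite /x /d; case: (posnP (r - B)%N) => [->|gt0].
    by rewrite addn0 (maxn_idPl h1).
  have lt : (tsum k (letter_deg k l).+1 <= tsum k (letter_deg k l + (r - B)))%N.
    by apply: tsum_le => //; lia.
  rewrite (maxn_idPr _); last exact: ltnW (leq_trans h2 lt).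
  by apply: letter_deg_eq; rewrite // leqnn tsum_ltS.
have BE : B = (letter_deg k l + \sum_(a < n | a != z) letter_deg k (row a))%N.
  by rewrite /B (bigD1 z) //= rz.
have lt_xN : (x < N)%N.
  have /andP[_] := letter_deg_bounds k_gt0 x; rewrite x_deg => /leq_trans; apply.
  by apply: tsum_le => //; rewrite /d; lia.
have row_le_l (a : 'I_n) : (row a <= l)%N by rewrite -ltnS prednK ?row_of_lt_size.
have lt_aN (a : 'I_n) : (row a < N)%N.
  by apply: leq_ltn_trans lt_xN; rewrite leq_max row_le_l.
pose T : {ffun 'I_n -> 'I_N} :=
  [ffun a => if a == z then Ordinal lt_xN else Ordinal (lt_aN a)].
have T_neq a : a != z -> T a = row a :> nat by rewrite ffunE => /negPf ->.
have T_ge (a : 'I_n) : (row a <= T a)%N.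
  by rewrite ffunE; case: eqP => //= _; rewrite leq_max row_le_l.
apply/card_gt0P; exists T; apply/andP; split.
  rewrite inE (bigD1 z) //= ffunE eqxx x_deg; apply/eqP.
  rewrite (eq_bigr (fun a : 'I_n => letter_deg k (row a))).
    by rewrite /d addnAC -BE subnKC.
  by move=> a ne; rewrite T_neq.
apply/is_ssytP; split=> a b e lt.
  rewrite T_neq ?e //; apply: contraTneq lt => ea.
  by rewrite ea cz -leqNgt -ltnS prednK // -rz -ea e; apply: col_of_lt_nth.
rewrite T_neq; first exact: leq_trans lt (T_ge b).
by apply: contraTneq lt => ->; rewrite rz -leqNgt.
Qed.

End MinimalDegree.

(** * The monomial basis *)

Section HomogeneousPolynomials.
Variables (F : numFieldType) (r k n : nat) (lam : seq nat).
Hypothesis lam_n : is_intpart n lam.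
Hypothesis k_gt0 : (0 < k)%N.
Local Notation nvars := #|{: 'I_n * 'I_k}|.
Local Notation N := (tsum k r.+1).
Local Notation letter i := (nth 0%MM (letters k r.+1) i).
Implicit Types T : {ffun 'I_n -> 'I_N}.

(* [letter_deg k i] is the degree of the letter [i], see [mdeg_letter]. *)
Definition fill_degree : pred {ffun 'I_n -> 'I_N} :=
  [pred T : {ffun 'I_n -> 'I_N} | (\sum_a letter_deg k (T a) == r)%N].

(* The monomial whose variables x_{i1}, ..., x_{ik} have the exponents of the
   letter [T i]. *)
Definition fill_xmon T : 'X_{1..nvars} :=
  [multinom letter (T (enum_val l).1) (enum_val l).2 | l < nvars].

Lemma fill_xmon_rank T i j : fill_xmon T (enum_rank (i, j)) = letter (T i) j.
Proof. by rewrite mnmE enum_rankK. Qed.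

Lemma sum_enum_rank (f : 'I_nvars -> nat) :
  (\sum_l f l = \sum_(i < n) \sum_(j < k) f (enum_rank (i, j)))%N.
Proof.
rewrite (reindex (@enum_rank {: 'I_n * 'I_k})) /=; last first.
  by apply: onW_bij; apply: enum_rank_bij.
by rewrite pair_bigA; apply: eq_bigr => -[].
Qed.

Lemma mdeg_fill_xmon T : mdeg (fill_xmon T) = (\sum_a letter_deg k (T a))%N.
Proof.
rewrite mdegE sum_enum_rank; apply: eq_bigr => a _.
rewrite -(mdeg_letter k_gt0 (ltn_ord (T a))) mdegE.
by apply: eq_bigr => j _; apply: fill_xmon_rank.
Qed.

Lemma fill_xmon_inj : injective fill_xmon.
Proof.
move=> T U /mnmP e; apply/ffunP => a; apply: val_inj; apply/eqP.
rewrite -(nth_uniq 0%MM (s := letters k r.+1))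
  ?(size_letters k_gt0) ?letters_uniq ?ltn_ord //.
by apply/eqP/mnmP => j; have := e (enum_rank (a, j)); rewrite !fill_xmon_rank.
Qed.

Lemma fill_xmon_surj m : mdeg m = r -> exists T, fill_xmon T = m.
Proof.
move=> m_deg; pose u (a : 'I_n) := [multinom m (enum_rank (a, j)) | j < k].
have uL a : u a \in letters k r.+1.
  rewrite mem_letters // ltnS -m_deg !mdegE sum_enum_rank (bigD1 a) //=.
  by rewrite (eq_bigr _ (fun j _ => mnmE _ j)) leq_addr.
have lt a : (index (u a) (letters k r.+1) < N)%N.
  by rewrite -size_letters // index_mem.
exists [ffun a => Ordinal (lt a)]; apply/mnmP => l.
rewrite -(enum_valK l); case: (enum_val l) => a j.
by rewrite fill_xmon_rank ffunE /= nth_index // mnmE.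
Qed.

Lemma mpoly_act_fill_xmon s T :
  mpoly_act s 'X_[fill_xmon T] = 'X_[fill_xmon (fill_act s T)] :> {mpoly F[nvars]}.
Proof.
rewrite /mpoly_act comp_mpolyX [RHS]mpolyXE_id.
rewrite !(reindex (@enum_rank {: 'I_n * 'I_k})) /=; last first.
- by apply: onW_bij; apply: enum_rank_bij.
- by apply: onW_bij; apply: enum_rank_bij.
pose sx (x : 'I_n * 'I_k) := (s x.1, x.2).
have sx_inj : injective sx by move=> [a j] [b l] [/perm_inj -> ->].
rewrite [RHS](reindex_inj sx_inj); apply: eq_bigr => -[a j] _ /=.
by rewrite tnth_mktuple enum_rankK !fill_xmon_rank ffunE permK.
Qed.

Definition fill_poly T : homog_poly F r k n :=
  insubd (0 : homog_poly F r k n) 'X_[fill_xmon T].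

Lemma val_fill_poly T : fill_degree T -> val (fill_poly T) = 'X_[fill_xmon T].
Proof. by move=> /eqP XT; rewrite val_insubd dhomogX /= mdeg_fill_xmon XT eqxx. Qed.

Definition fill_poly_coef T (p : homog_poly F r k n) : F := (val p)@_(fill_xmon T).

Lemma fill_poly_coef_is_linear T : scalar (fill_poly_coef T).
Proof. by move=> a p q; rewrite /fill_poly_coef /= mcoeffD mcoeffZ. Qed.

HB.instance Definition _ T := GRing.isLinear.Build F (homog_poly F r k n) F _
  (fill_poly_coef T) (fill_poly_coef_is_linear T).

Lemma fill_degree_stable s T : fill_degree T -> fill_degree (fill_act s T).
Proof.
suff -> : fill_degree (fill_act s T) = fill_degree T by [].
congr (_ == _); rewrite [LHS](reindex_inj (@perm_inj _ s)) /=.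
by apply: eq_bigr => a _; rewrite ffunE permK.
Qed.

Lemma poly_actM s t (p : homog_poly F r k n) :
  poly_act F r k s (poly_act F r k t p) = poly_act F r k (perm_comp s t) p.
Proof. by apply: val_inj; rewrite /= !poly_actE mpoly_act_comp. Qed.

Lemma dim_cent_module : \dim (cent_module F r k n lam) = #|ssyt_in lam fill_degree|.
Proof.
rewrite /cent_module dim_equiHom_specht; last exact: poly_actM.
apply: (dim_young_symmetrizer_image lam_n fill_degree_stable (v := fill_poly)
  (co := fun T => fill_poly_coef T) _ _ _) => [s T XT|T U XT XU|p].
- apply: val_inj; rewrite /= poly_actE [mpoly_of_dhomog _]val_fill_poly //.
  rewrite mpoly_act_fill_xmon.
  by rewrite [RHS]val_fill_poly // fill_degree_stable.
- by rewrite /= /fill_poly_coef val_fill_poly // mcoeffX (inj_eq fill_xmon_inj) eq_sym.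
apply: val_inj; apply/mpolyP => m; rewrite !raddf_sum /=.
rewrite (eq_bigr (fun T => fill_poly_coef T p * (fill_xmon T == m)%:R)); last first.
  by move=> T XT; rewrite mcoeffZ [mpoly_of_dhomog _]val_fill_poly // mcoeffX.
have [m_r|/eqP m_deg] := eqVneq (mdeg m) r.
  have [T e] := fill_xmon_surj m_r.
  have XT : fill_degree T.
    by rewrite /fill_degree inE -mdeg_fill_xmon e m_r.
  rewrite (bigD1 T) //= e eqxx mulr1 big1 ?addr0 /fill_poly_coef ?e // => U /andP[_ ne].
  by rewrite -e (inj_eq fill_xmon_inj) (negPf ne) mulr0.
rewrite (dhomog_nemf_coeff (valP p)); last exact/eqP.
rewrite big1 // => T /eqP XT; case: eqP => [e|]; last by rewrite mulr0.
by case: m_deg; rewrite -e mdeg_fill_xmon.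
Qed.

End HomogeneousPolynomials.

Theorem proposition5p2 (R : realType) (n k r : nat) (lam : seq nat)
    (n_gt0 : (0 < n)%N) (k_gt0 : (0 < k)%N) (r_gt0 : (0 < r)%N)
    (lam_n : is_intpart n lam) :
  [/\ (\dim (cent_module R[i] r k n lam))%:R
        = fps_coef (schur_plethysm n k lam) r,
      fps_coef (schur_plethysm n k lam) r <> 0
        <-> (deg_bound k lam <= r)%N
    & cent_module R[i] r k n lam <> 0%VS <-> (deg_bound k lam <= r)%N].
Proof.
have coefE : fps_coef (schur_plethysm n k lam) r = #|ssyt_in lam (@fill_degree r k n)|%:R.
  apply: (@schur_plethysm_coef _ _ _ _ (fun i : 'I_(tsum k r.+1) => letter_deg k i)
    _ lam_n) => d led.
  rewrite -(count_letters k_gt0 (D := r.+1)) // -sum1_count (big_nth 0%MM) size_letters //.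
  rewrite big_mkord -sum1_card; apply: eq_bigl => i.
  by rewrite inE mdeg_letter.
have dimE := dim_cent_module R[i] r lam_n k_gt0.
have ssytE := exists_ssyt_degree r lam_n k_gt0 n_gt0.
split; first by rewrite dimE coefE.
  rewrite coefE -ssytE lt0n; split=> [/eqP|h]; first by rewrite pnatr_eq0.
  by apply/eqP; rewrite pnatr_eq0.
rewrite -ssytE lt0n -[#|_|]dimE dimv_eq0; split=> [/eqP|h] //.
exact/eqP.
Qed.
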